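(* Let $a<b$, $0<\alpha<1$, $r>0$, $0<\sigma<1$, and let $u$ be the solution of the steady-state nonlocal problem $$-\int_a^b\frac{u(y)-u(x)}{|x-y|^\alpha}\,dy=f(x),\quad x\in(a,b),\qquad u(x)=0,\quad x\in\mathbb{R}\setminus(a,b).$$ Suppose that $u\in C^2(a,b)$ and that there is a constant $C_0$ with $$|u^{(\ell)}(x)|\le C_0[(x-a)(b-x)]^{\sigma-\ell},\qquad x\in(a,b),\ \ell=0,1,2.$$ For each integer $N\ge2$ let $U=(u_1,\dots,u_{2N-1})^T$ be the solution of the piecewise linear collocation scheme $AU=F$ on the graded mesh $x_0<x_1<\dots<x_{2N}$ with grading exponent $r$ (see context). Then there is a constant $C>0$, independent of $N$, such that $$\max_{1\le i\le 2N-1}|u(x_i)-u_i|\le\begin{cases} C N^{r-2}, & \text{if } r(1+\sigma)>2,\\ C N^{r-2}\ln N, & \text{if } r(1+\sigma)=2,\\ C N^{-r\sigma}, & \text{if } r(1+\sigma)<2.\end{cases}$$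
   Context: Graded mesh: for $r>0$ and a positive integer $N$, $x_j=a+\frac{b-a}{2}\left(\frac jN\right)^r$ for $j=0,1,\dots,N$ and $x_j=b-\frac{b-a}{2}\left(2-\frac jN\right)^r$ for $j=N+1,\dots,2N$. Hat functions: $\phi_j$, $0\le j\le 2N$, is the continuous function on $[a,b]$ that is affine on each $[x_{k-1},x_k]$ and satisfies $\phi_j(x_k)=\delta_{jk}$. Collocation scheme: $A=(a_{i,k})\in\mathbb{R}^{(2N-1)\times(2N-1)}$ with $a_{i,k}=\int_a^b\frac{\phi_k(x_i)-\phi_k(y)}{|x_i-y|^\alpha}\,dy$ for $i,k=1,\dots,2N-1$; $F=(f(x_1),\dots,f(x_{2N-1}))^T$; the scheme is $AU=F$ (the matrix $A$ is nonsingular), and $u_i$ is the approximation of $u(x_i)$. The constant $C$ may depend on $u,\alpha,\sigma,r,a,b$ but not on $N$. *)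

(* Defs.v *)
From HB Require Import structures.
From mathcomp Require Import all_boot all_order all_algebra.
From mathcomp Require Import all_classical all_reals all_analysis.

Set Implicit Arguments.
Unset Strict Implicit.
Unset Printing Implicit Defensive.

Import Order.TTheory GRing.Theory Num.Theory.
Import numFieldNormedType.Exports.

Local Open Scope classical_set_scope.
Local Open Scope ring_scope.

Definition is_C2_on (R : realType) (a b : R) (u : R -> R) : Prop :=
  forall x, a < x < b ->
    [/\ derivable u x 1, derivable (u^`())%classic x 1 & {for x, continuous (u^`(2))%classic}].

(* At [y = x] the integrands below are [0 / 0 = 0] since [0 `^ alpha = 0] for
   [alpha != 0]; a single point does not affect the Lebesgue integral. *)
Definition solves_nonlocal_problem (R : realType) (a b alpha : R)
    (f u : R -> R) : Prop :=
  (forall x, a < x < b ->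
     - (\int[lebesgue_measure]_(y in `[a, b]%classic)
          ((u y - u x) / `|x - y| `^ alpha)) = f x) /\
  (forall x, ~~ (a < x < b) -> u x = 0).

Definition mesh (R : realType) (a b r : R) (N j : nat) : R :=
  if (j <= N)%N then a + (b - a) / 2 * (j%:R / N%:R) `^ r
  else b - (b - a) / 2 * (2 - j%:R / N%:R) `^ r.

(* [phi] is constrained on [[a, b]] only, where it is uniquely determined for
   [j <= 2 * N]. *)
Definition hat_functions (R : realType) (a b r : R) (N : nat)
    (phi : nat -> R -> R) : Prop :=
  forall j, (j <= 2 * N)%N ->
    [/\ {within `[a, b]%classic, continuous (phi j)},
        forall k, (1 <= k <= 2 * N)%N ->
          exists p q : R, forall y,
            mesh a b r N k.-1 <= y <= mesh a b r N k -> phi j y = p * y + q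
      & forall k, (k <= 2 * N)%N -> phi j (mesh a b r N k) = (j == k)%:R].

(* Row and column [i : 'I_((2 * N).-1)] correspond to the node of index
   [i.+1], so that the nodes range over the interior indices 1, ..., 2N - 1. *)
Definition colloc_mx (R : realType) (a b alpha r : R) (N : nat)
    (phi : nat -> R -> R) : 'M[R]_((2 * N).-1) :=
  \matrix_(i, k)
    \int[lebesgue_measure]_(y in `[a, b]%classic)
      ((phi k.+1 (mesh a b r N i.+1) - phi k.+1 y)
         / `|mesh a b r N i.+1 - y| `^ alpha).

Definition colloc_rhs (R : realType) (a b r : R) (N : nat) (f : R -> R) :
    'cV[R]_((2 * N).-1) :=
  \col_i f (mesh a b r N i.+1).

Definition error_rate (R : realType) (r sigma : R) (N : nat) : R :=
  if 2 < r * (1 + sigma) then N%:R `^ (r - 2)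
  else if r * (1 + sigma) == 2 then N%:R `^ (r - 2) * ln N%:R
  else N%:R `^ (- (r * sigma)).

(* Main.v *)
Require Import Defs.
From HB Require Import structures.
From mathcomp Require Import all_boot all_order all_algebra.
From mathcomp Require Import all_classical all_reals all_analysis.
From mathcomp Require Import measurable_realfun.
From mathcomp Require Import ring lra.
Import Order.TTheory GRing.Theory Num.Theory.
Import numFieldNormedType.Exports.
Local Open Scope classical_set_scope.
Local Open Scope ring_scope.

(** Write e_i = u(x_i) - u_i, let Pi u be the piecewise linear interpolant of u
    and w_i(y) = |x_i - y|^-alpha.  Then A e = rho with
    rho_i = int_a^b (u - Pi u) w_i, and A is an M-matrix (nonpositive
    off-diagonal entries, positive row sums S_i), so that
    max_i |e_i| <= max_i |rho_i| / S_i.  Since S_i is the integral of w_i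
    against the two end hats, it is at least c s |x_i - z|^-alpha for z = a, b,
    where s = (b - a)/2 N^-r is the first step.  It is the weight
    |x_i - z|^-alpha that makes the bound uniform in i: rho_i alone is not
    O(N^-2) near the endpoints.

    On the graded mesh, |u - Pi u|(y) <= K N^-2 sum_z max(|y - z|, s)^kappa with
    kappa = sigma - 2/r.  In the integral against w_i, away from x_i (at
    distance > d/2, d = |x_i - z|) the kernel is at most (d/2)^-alpha, and close
    to x_i the interpolation bound is comparable to d^kappa.  This yields
    K d^-alpha (s^(kappa+1) + int_s^(b-a) t^kappa dt + d^(kappa+1)), and the
    three regimes of the rate are the three signs of
    kappa + 1 = (r (1 + sigma) - 2) / r. *)

Set Implicit Arguments.
Unset Strict Implicit.

(** * Comparison of real powers *)

Lemma ler_ppowR (R : realType) (e s t : R) :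
  0 <= e -> 0 <= s -> s <= t -> s `^ e <= t `^ e.
Proof.
move=> e0 s0 st; apply: (@ge0_ler_powR _ _ e0 s t) => //.
by rewrite nnegrE (le_trans s0).
Qed.

Lemma ler_npowR (R : realType) (e s t : R) :
  e <= 0 -> 0 < s -> s <= t -> t `^ e <= s `^ e.
Proof.
move=> e0 s0 st; have t0 : 0 < t by exact: lt_le_trans st.
rewrite -[e]opprK (powRN t (- e)) (powRN s (- e)) lef_pV2 ?posrE ?powR_gt0//.
by rewrite ler_ppowR ?oppr_ge0// ltW.
Qed.

Lemma powR_add1 (R : realType) (x e : R) : 0 < x -> x `^ (e + 1) = x `^ e * x.
Proof.
move=> x0; rewrite powRD; last by rewrite (gt_eqF x0) implybT.
by rewrite powRr1// ltW.
Qed.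

(** The exponent [sigma - 2 / r] has no fixed sign. For [e >= 0] the power is increasing and
    [t <= K * s] is used, for [e < 0] it is decreasing and [s <= K * t] is used. *)
Lemma powR_comparable (R : realType) (K e s t : R) :
  1 <= K -> 0 < s -> 0 < t -> s <= K * t -> t <= K * s ->
  t `^ e <= K `^ `|e| * s `^ e.
Proof.
move=> K1 s0 t0 sKt tKs; have K0 : 0 < K by exact: lt_le_trans K1.
have [K0' s0' t0'] := And3 (ltW K0) (ltW s0) (ltW t0).
have [e0|e0] := leP 0 e.
  by rewrite ger0_norm// -powRM// ler_ppowR.
rewrite ltr0_norm// powRN mulrC ler_pdivlMr ?powR_gt0//.
by rewrite -powRM// [t * K]mulrC ler_npowR// ltW.
Qed.

Lemma exprDn_le_affine (R : realType) (v : R) (n : nat) :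
  0 <= v <= 1 -> (1 + v) ^+ n <= 1 + 2 ^+ n * v.
Proof.
move=> /andP[v0 v1].
(* By convexity the power stays below its chord, whose slope is [2 ^+ n - 1]; this sharper bound is
   the one that passes through the induction. *)
suff : (1 + v) ^+ n <= 1 + (2 ^+ n - 1) * v.
  by move=> /le_trans; apply; rewrite mulrBl mul1r lerD2l gerBl.
elim: n => [|n IH]; first by rewrite !expr0 subrr mul0r addr0.
rewrite exprS [2 ^+ n.+1]exprS.
have h : 1 <= 2 ^+ n :> R by rewrite exprn_ege1// ler1n.
have := @ler_wpM2l _ (1 + v) _ _ _ IH; rewrite addr_ge0// => /(_ isT).
move=> /le_trans; apply; move: (2 ^+ n) h => P h.
(* This product is exactly the gap left in the induction step. *)
have : 0 <= (P - 1) * (v * (1 - v)) by rewrite !mulr_ge0 ?subr_ge0.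
nra.
Qed.

(** Controls the relative size of a mesh step: the node of index [n] lies at a distance proportional
    to [(n / N) ^ r] from its endpoint, and the next step is at most [K / n] times that distance.
    Rounding [r] up to a natural number reduces the claim to integer powers of [1 + 1 / n]. *)
Lemma powR_step (R : realType) (r : R) : 0 < r ->
  exists2 K : R, 1 <= K & forall n N : nat, (0 < n)%N -> (0 < N)%N ->
    (n.+1%:R / N%:R) `^ r <= (1 + K / n%:R) * (n%:R / N%:R) `^ r.
Proof.
move=> r0; pose k := Num.bound r.
exists (2 ^+ k); first by rewrite exprn_ege1// ler1n.
move=> n N n0 N0.
have n0' : 0 < n%:R :> R by rewrite ltr0n.
have -> : n.+1%:R / N%:R = (1 + n%:R^-1) * (n%:R / N%:R) :> R.
  by rewrite -natr1; field; rewrite !pnatr_eq0 -!lt0n n0 N0.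
rewrite powRM ?divr_ge0 ?addr_ge0 ?invr_ge0 ?ler0n//.
rewrite ler_wpM2r ?powR_ge0//.
have v01 : 0 <= (n%:R^-1 : R) <= 1.
  by apply/andP; split; rewrite ?invr_ge0 ?ler0n ?invf_le1 ?ler1n.
apply: le_trans (exprDn_le_affine k v01).
rewrite -powR_mulrn; last by rewrite addr_ge0// invr_ge0.
apply: ler_powR; first by rewrite lerDl invr_ge0.
by apply: ltW; apply: archi_boundP; exact: ltW.
Qed.

(** * Integrals of powers of a distance *)

Lemma powR_dist_continuous (R : realType) (c k y : R) : y != c ->
  {for y, continuous (fun z : R => `|z - c| `^ k)}.
Proof.
move=> yc; have yc0 : 0 < `|y - c| by rewrite normr_gt0 subr_eq0.
apply: (@continuous_comp _ _ _ (fun z : R => `|z - c|) (fun s => s `^ k)).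
  apply: continuous_comp; last exact: norm_continuous.
  by apply: cvgB; [exact: cvg_id|exact: cvg_cst].
apply: differentiable_continuous; apply/derivable1_diffP.
by apply: derivable_powR; rewrite in_itv/= yc0.
Qed.

Lemma measurable_powR_dist (R : realType) (c k : R) (D : set R) :
  measurable_fun D (fun y : R => `|y - c| `^ k).
Proof.
apply: measurable_funS (subsetT D) _ => //.
apply: (measurableT_comp (measurable_powR k)).
by apply: measurableT_comp => //; exact: measurable_funB.
Qed.

(** The antiderivative [G] is left abstract so that powers and the logarithm are treated together.
    The interval keeps distance [e > 0] from [c], so the fundamental theorem of calculus meets no
    singularity. *)
Lemma integral_powR_right (R : realType) (c k e l : R) (G : R -> R) :
  0 < e -> e < l -> (forall s : R, 0 < s -> is_derive s 1 G (s `^ k)) ->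
  (\int[lebesgue_measure]_(y in `[(c + e)%R, (c + l)%R]) (`|y - c| `^ k)%:E
     = (G l)%:E - (G e)%:E)%E.
Proof.
move=> e0 el dG; have l0 : 0 < l by exact: lt_trans el.
have dF y : c < y -> is_derive y 1 (fun y => G (y - c)) (`|y - c| `^ k).
  move=> cy; have yc : 0 < y - c by rewrite subr_gt0.
  have := dG _ yc => dGy.
  have dsub : is_derive y 1 (fun z : R => z - c) 1.
    by rewrite -[X in is_derive _ _ _ X]subr0; exact: is_deriveB.
  have := @is_derive1_comp _ G (fun z => z - c) y _ _ dGy dsub.
  by rewrite mulr1 gtr0_norm.
have cF y : c < y -> {for y, continuous (fun y => G (y - c))}.
  move=> cy; apply: differentiable_continuous; apply/derivable1_diffP.
  by have [] := dF _ cy.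
rewrite (@continuous_FTC2 _ _ (fun y => G (y - c))).
- by congr (_%:E - _%:E)%E; congr G; ring.
- by rewrite ltrD2l.
- apply: continuous_in_subspaceT => y; rewrite inE/= in_itv/= => /andP[yl _].
  by apply: powR_dist_continuous; rewrite gt_eqF// (lt_le_trans _ yl)// ltrDl.
- split.
  + move=> y; rewrite in_itv/= => /andP[yl _].
    by have [] := dF y (lt_trans _ yl) => //; rewrite ltrDl.
  + by apply: cvg_at_right_filter; apply: cF; rewrite ltrDl.
  + by apply: cvg_at_left_filter; apply: cF; rewrite ltrDl.
- move=> y; rewrite in_itv/= => /andP[yl _].
  have := dF y (lt_trans _ yl); rewrite ltrDl => /(_ e0) h.
  by rewrite derive1E derive_val.
Qed.

Lemma integral_powR_left (R : realType) (c k e l : R) (G : R -> R) :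
  0 < e -> e < l -> (forall s : R, 0 < s -> is_derive s 1 G (s `^ k)) ->
  (\int[lebesgue_measure]_(y in `[(c - l)%R, (c - e)%R]) (`|y - c| `^ k)%:E
     = (G l)%:E - (G e)%:E)%E.
Proof.
move=> e0 el dG; have l0 : 0 < l by exact: lt_trans el.
have dF y : y < c -> is_derive y 1 (fun y => - G (c - y)) (`|y - c| `^ k).
  move=> cy; have yc : 0 < c - y by rewrite subr_gt0.
  have := dG _ yc => dGy.
  have dsub : is_derive y 1 (fun z : R => c - z) (-1).
    by rewrite -[-1]sub0r; exact: is_deriveB.
  have := @is_derive1_comp _ G (fun z => c - z) y _ _ dGy dsub => h.
  by apply: is_derive_eq; rewrite mulrN1 opprK distrC gtr0_norm.
have cF y : y < c -> {for y, continuous (fun y => - G (c - y))}.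
  move=> cy; apply: differentiable_continuous; apply/derivable1_diffP.
  by have [] := dF _ cy.
rewrite (@continuous_FTC2 _ _ (fun y => - G (c - y))).
- rewrite -!EFinB opprK addrC; congr (_%:E); congr (G _ - G _); ring.
- by rewrite ltrD2l ltrN2.
- apply: continuous_in_subspaceT => y; rewrite inE/= in_itv/= => /andP[_ yl].
  by apply: powR_dist_continuous; rewrite lt_eqF// (le_lt_trans yl)// gtrBl.
- split.
  + move=> y; rewrite in_itv/= => /andP[_ yl].
    by have [] := dF y (lt_trans yl _) => //; rewrite gtrBl.
  + by apply: cvg_at_right_filter; apply: cF; rewrite gtrBl.
  + by apply: cvg_at_left_filter; apply: cF; rewrite gtrBl.
- move=> y; rewrite in_itv/= => /andP[_ yl].
  have := dF y (lt_trans yl _); rewrite gtrBl => /(_ e0) h.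
  by rewrite derive1E derive_val.
Qed.

Lemma ge0_integral_cover (d : measure_display) (T : measurableType d)
    (R : realType) (mu : {measure set T -> \bar R}) (D A B : set T)
    (f : T -> \bar R) :
  measurable D -> measurable A -> measurable B ->
  measurable_fun [set: T] f -> (forall x, 0 <= f x)%E -> D `<=` A `|` B ->
  (\int[mu]_(x in D) f x <= \int[mu]_(x in A) f x + \int[mu]_(x in B) f x)%E.
Proof.
move=> mD mA mB mf f0 DAB.
have mfS E : measurable_fun E f by exact: measurable_funS mf.
have DAB' : D `<=` A `|` (B `\` A).
  move=> x /DAB[Ax|Bx]; first by left.
  by have [Ax|Ax] := pselect (A x); [left|right].
have mBA : measurable (B `\` A) by exact: measurableD.
apply: (@le_trans _ _ (\int[mu]_(x in A `|` (B `\` A)) f x)%E).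
  by apply: ge0_subset_integral => //; exact: measurableU.
rewrite ge0_integral_setU//; last by rewrite disj_set2E setDE setICA setICr setI0.
by rewrite leeD2l// ge0_subset_integral//; exact: subDsetl.
Qed.

Lemma measurable_annulus (R : realType) (c e l : R) :
  measurable [set y : R | e <= `|y - c| <= l].
Proof.
rewrite (_ : mkset _ = setT `&` (fun y : R => `|y - c|) @^-1` `[e, l]%classic).
  have : measurable_fun [set: R] (fun y : R => `|y - c|).
    by apply: measurableT_comp => //; exact: measurable_funB.
  by apply.
by apply/seteqP; split => y /=; rewrite in_itv/=; tauto.
Qed.

Lemma integral_powR_annulus_le (R : realType) (c k e l : R) (G : R -> R) :
  0 < e -> e <= l -> (forall s : R, 0 < s -> is_derive s 1 G (s `^ k)) ->
  (\int[lebesgue_measure]_(y in [set y | (e <= `|y - c| <= l)%R])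
     (`|y - c| `^ k)%:E <= (2 * (G l - G e))%:E)%E.
Proof.
move=> e0 el dG.
apply: (@le_trans _ _ (\int[lebesgue_measure]_(y in `[(c - l)%R, (c - e)%R])
    (`|y - c| `^ k)%:E + \int[lebesgue_measure]_(y in `[(c + e)%R, (c + l)%R])
    (`|y - c| `^ k)%:E)%E).
  apply: ge0_integral_cover => //.
  - exact: measurable_annulus.
  - by apply/measurable_EFinP; exact: measurable_powR_dist.
  - move=> y /= /andP[]; rewrite !in_itv/=; have [yc|yc] := leP c y.
      rewrite ger0_norm ?subr_ge0// => h1 h2; right; apply/andP; split; lra.
    rewrite ltr0_norm ?subr_lt0// => h1 h2; left; apply/andP; split; lra.
(* For [e = l] both intervals are points, outside the scope of the integral formulas, which need
   [e < l]. *)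
move: el; rewrite le_eqVlt => /predU1P[->|el].
  by rewrite !set_itv1 !integral_set1 adde0 subrr mulr0.
rewrite (integral_powR_left _ e0 el dG) (integral_powR_right _ e0 el dG).
by rewrite -!EFinB -EFinD lee_fin mulr_natl mulr2n.
Qed.

Lemma is_derive_powR_primitive (R : realType) (q s : R) : q != 0 -> 0 < s ->
  is_derive s 1 (fun s : R => s `^ q / q) (s `^ (q - 1)).
Proof.
move=> q0 s0.
have h := is_derive1_powR q s0.
have := @is_deriveM R R (fun s => s `^ q) (cst q^-1) s 1 _ _ h (is_derive_cst _ _ _).
by rewrite scaler0 add0r /= /GRing.scale/= mulrA mulVf// mul1r.
Qed.

(* At [y = x] the kernel is [0 `^ (- al) = 0], so the centre can be removed. *)
Lemma integral_kernel_ball_le (R : realType) (al x l : R) :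
  0 < al < 1 -> 0 < l ->
  (\int[lebesgue_measure]_(y in [set y | (`|y - x| <= l)%R])
     (`|y - x| `^ (- al))%:E <= (2 * (l `^ (1 - al) / (1 - al)))%:E)%E.
Proof.
move=> /andP[al0 al1] l0; pose q := 1 - al.
have q0 : 0 < q by rewrite subr_gt0.
pose e (n : nat) := l / n.+1%:R.
have e0 n : 0 < e n by rewrite divr_gt0.
have el n : e n <= l by rewrite ler_pdivrMr// ler_peMr ?ler1n// ltW.
(* The annuli [A n] exhaust the ball without its centre; their integrals are bounded uniformly in
   [n], and monotone convergence carries the bound to the union. *)
pose A n := [set y | e n <= `|y - x| <= l].
have -> : (\int[lebesgue_measure]_(y in [set y | (`|y - x| <= l)%R])
     (`|y - x| `^ (- al))%:E = \int[lebesgue_measure]_(y in \bigcup_n A n)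
     (`|y - x| `^ (- al))%:E)%E.
  rewrite integral_mkcond [RHS]integral_mkcond; apply: eq_integral => y _.
  rewrite !patchE; have [yx|yx] := eqVneq y x.
    rewrite yx subrr normr0 powR0 ?oppr_eq0 ?gt_eqF//.
    by case: ifP; case: ifP.
  suff -> : (y \in [set y | `|y - x| <= l]) = (y \in \bigcup_n A n) by [].
  apply/idP/idP; rewrite !inE/=; last by move=> [n _ /andP[]].
  move=> yl; have yx0 : 0 < `|y - x| by rewrite normr_gt0 subr_eq0.
  exists (Num.bound (l / `|y - x|)) => //; apply/andP; split => //.
  rewrite ler_pdivrMr// mulrC -ler_pdivrMr//.
  have := archi_boundP (divr_ge0 (ltW l0) (ltW yx0)).
  by move=> /ltW /le_trans; apply; rewrite ler_nat.
have cv : (\int[lebesgue_measure]_(y in A n) (`|y - x| `^ (- al))%:E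
    @[n --> \oo] --> \int[lebesgue_measure]_(y in \bigcup_n A n)
     (`|y - x| `^ (- al))%:E)%E.
  apply: ge0_nondecreasing_set_cvg_integral.
  - apply/nondecreasing_seqP => n; apply/subsetPset => y /= /andP[h1 h2].
    rewrite /A/= h2 andbT (le_trans _ h1)// /e ler_pM2l// lef_pV2 ?posrE//.
    by rewrite ler_nat.
  - by move=> n; exact: measurable_annulus.
  - by move=> n; apply/measurable_EFinP; exact: measurable_powR_dist.
  - by move=> n y _; rewrite lee_fin powR_ge0.
rewrite -(cvg_lim _ cv)//; apply: lime_le; first by apply/cvg_ex; eexists; exact: cv.
apply: nearW => n.
have dG (s : R) : 0 < s -> is_derive s 1 (fun s : R => s `^ q / q) (s `^ (- al)).
  move=> s0; have qn0 : q != 0 by rewrite gt_eqF.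
  have := is_derive_powR_primitive qn0 s0.
  by rewrite /q addrAC subrr sub0r.
apply: le_trans (integral_powR_annulus_le x (e0 n) (el n) dG) _.
by rewrite lee_fin ler_pM2l// gerBl divr_ge0 ?powR_ge0// ltW.
Qed.

Lemma integrable_kernel (R : realType) (al x a b : R) : 0 < al < 1 ->
  lebesgue_measure.-integrable `[a, b]
    (EFin \o (fun y : R => `|y - x| `^ (- al))).
Proof.
move=> al01; apply/integrableP; split.
  by apply/measurable_EFinP; exact: measurable_powR_dist.
pose l := `|a - x| + `|b - x| + 1.
have l0 : 0 < l by rewrite ltr_wpDl// addr_ge0.
apply: le_lt_trans (ltry (2 * (l `^ (1 - al) / (1 - al)))).
apply: le_trans (integral_kernel_ball_le x al01 l0).
have m : measurable [set y : R | (`|y - x| <= l)%R].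
  have := measurable_annulus x 0 l; congr (measurable _).
  by apply/seteqP; split => y /=; rewrite normr_ge0.
under eq_integral do rewrite /= ger0_norm ?powR_ge0//.
apply: ge0_subset_integral => //.
  by apply/measurable_EFinP; exact: measurable_powR_dist.
move=> y /=; rewrite in_itv/= => /andP[ay yb]; rewrite /l.
rewrite ler_norml; apply/andP; split.
  have := ler_norm (- (a - x)); rewrite normrN; have := normr_ge0 (b - x); lra.
have := ler_norm (b - x); have := normr_ge0 (a - x); lra.
Qed.

(** The truncation freezes the weight at [s ^ k] on an interval of length [2 * s], which gives the
    first term; the rest of [D] lies in an annulus. *)
Lemma integral_max_powR_le (R : realType) (k c s l : R) (G : R -> R) (D : set R) :
  0 < s -> s <= l -> (forall s : R, 0 < s -> is_derive s 1 G (s `^ k)) ->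
  measurable D -> (forall y, D y -> `|y - c| <= l) ->
  (\int[lebesgue_measure]_(y in D) (Num.max `|y - c| s `^ k)%:E
    <= (2 * s `^ (k + 1) + 2 * (G l - G s))%:E)%E.
Proof.
move=> s0 sl dG mD Dl.
have mm (E : set R) : measurable_fun E (fun y : R => (Num.max `|y - c| s `^ k)%:E).
  apply/measurable_EFinP; apply: measurable_funS (subsetT E) _ => //.
  apply: (measurableT_comp (measurable_powR k)).
  apply: measurable_maxr => //.
  by apply: measurableT_comp => //; exact: measurable_funB.
apply: (@le_trans _ _ (\int[lebesgue_measure]_(y in `[(c - s)%R, (c + s)%R])
    (Num.max `|y - c| s `^ k)%:E +
  \int[lebesgue_measure]_(y in [set y | (s <= `|y - c| <= l)%R])
    (Num.max `|y - c| s `^ k)%:E)%E).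
  apply: ge0_integral_cover => //; [exact: measurable_annulus|exact: mm| |].
    by move=> y; rewrite lee_fin powR_ge0.
  move=> y /Dl yl; have [h|h] := leP `|y - c| s.
    left => /=; rewrite in_itv/=; move: h; rewrite ler_norml => /andP[? ?].
    by apply/andP; split; lra.
  by right => /=; rewrite yl (ltW h).
rewrite EFinD; apply: leeD.
  rewrite (@eq_integral _ _ _ lebesgue_measure _ (cst (s `^ k)%:E)); last first.
    move=> y; rewrite inE/= in_itv/= => /andP[h1 h2]; rewrite max_r//.
    by rewrite ler_norml; apply/andP; split; lra.
  rewrite integral_cst//=.
  rewrite lebesgue_measure_itv/= lte_fin ifT; last by lra.
  rewrite -EFinD -EFinM lee_fin powR_add1//.
  lra.
rewrite (@eq_integral _ _ _ lebesgue_measure _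
  (fun y => (`|y - c| `^ k)%:E)); last first.
  by move=> y; rewrite inE/= => /andP[h1 h2]; rewrite max_l.
exact: integral_powR_annulus_le.
Qed.

(** The ball of radius [d / 2] around [x], where [d] is the distance from [x] to [c], separates the
    two singularities: inside it the weight is comparable to [d ^ k] and the kernel is integrated,
    outside it the kernel is at most [(d / 2) ^ (- al)] and the weight is integrated. [K] depends on
    [al] and [k] only, hence neither on the node nor on the mesh. *)
Lemma weighted_kernel_le (R : realType) (al k : R) : 0 < al < 1 ->
  exists2 K : R, 0 < K & forall (c x s l : R) (G : R -> R) (D : set R),
    0 < s -> s <= l -> (forall s : R, 0 < s -> is_derive s 1 G (s `^ k)) ->
    measurable D -> (forall y, D y -> `|y - c| <= l) -> s <= `|x - c| ->
    (\int[lebesgue_measure]_(y in D)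
       (Num.max `|y - c| s `^ k * `|y - x| `^ (- al))%:E
     <= (K * `|x - c| `^ (- al) *
         (s `^ (k + 1) + (G l - G s) + `|x - c| `^ (k + 1)))%:E)%E.
Proof.
move=> al01; have /andP[al0 al1] := al01.
pose K1 : R := 2 `^ `|k| * 2 / (1 - al).
have K10 : 0 < K1 by rewrite divr_gt0 ?mulr_gt0 ?powR_gt0 ?subr_gt0.
(* [K1] comes from the ball; 4 is the factor 2 of [e1] times the factor 2 of
   [integral_max_powR_le]. *)
exists (K1 + 4) => [|c x s l G D s0 sl dG mD Dl sx]; first by rewrite addr_gt0.
set d := `|x - c|; have d0 : 0 < d by exact: lt_le_trans sx.
have mmax (E : set R) : measurable_fun E (fun y : R => Num.max `|y - c| s `^ k).
  apply: measurable_funS (subsetT E) _ => //.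
  apply: (measurableT_comp (measurable_powR k)).
  apply: measurable_maxr => //.
  by apply: measurableT_comp => //; exact: measurable_funB.
have mker (E : set R) : measurable_fun E (fun y : R => `|y - x| `^ (- al)).
  exact: measurable_powR_dist.
have mprod (E : set R) : measurable_fun E
    (fun y : R => (Num.max `|y - c| s `^ k * `|y - x| `^ (- al))%:E).
  by apply/measurable_EFinP; exact: measurable_funM.
have mcmax C (E : set R) :
    measurable_fun E (fun y : R => (C * Num.max `|y - c| s `^ k)%:E).
  by apply/measurable_EFinP; apply: measurable_funM => //; exact: measurable_cst.
have mcker C (E : set R) :
    measurable_fun E (fun y : R => (C * `|y - x| `^ (- al))%:E).
  by apply/measurable_EFinP; apply: measurable_funM => //; exact: measurable_cst.
pose N := [set y : R | `|y - x| <= d / 2].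
have mN : measurable N.
  have := measurable_annulus x 0 (d / 2); congr (measurable _).
  by apply/seteqP; split => y /=; rewrite normr_ge0.
have d20 : 0 < d / 2 by rewrite divr_gt0.
apply: (@le_trans _ _ (\int[lebesgue_measure]_(y in N)
       (Num.max `|y - c| s `^ k * `|y - x| `^ (- al))%:E +
     \int[lebesgue_measure]_(y in D `\` N)
       (Num.max `|y - c| s `^ k * `|y - x| `^ (- al))%:E)%E).
  apply: ge0_integral_cover => //; [exact: measurableD|exact: mprod| |].
    by move=> y; rewrite lee_fin mulr_ge0 ?powR_ge0.
  by move=> y Dy; have [Ny|Ny] := pselect (N y); [left|right].
have near : (\int[lebesgue_measure]_(y in N)
       (Num.max `|y - c| s `^ k * `|y - x| `^ (- al))%:E <=
     (2 `^ `|k| * d `^ k * (2 * ((d / 2) `^ (1 - al) / (1 - al))))%:E)%E.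
  apply: (@le_trans _ _ (\int[lebesgue_measure]_(y in N)
    (2 `^ `|k| * d `^ k * `|y - x| `^ (- al))%:E)%E).
    apply: ge0_le_integral => //.
    - by move=> y _; rewrite lee_fin mulr_ge0 ?powR_ge0.
    - exact: mprod.
    - exact: mcker.
    - move=> y; rewrite /N/= => yN; rewrite lee_fin ler_wpM2r ?powR_ge0//.
      (* In the ball the distance from [y] to [c] lies between [d / 2] and [3 * d / 2]; as [s <= d],
         the maximum is comparable to [d] with constant 2. *)
      have t1 : d <= `|y - c| + `|y - x|.
        by rewrite [`|y - x|]distrC addrC ler_distD.
      have t2 : `|y - c| <= `|y - x| + d by rewrite ler_distD.
      have m1 : `|y - c| <= Num.max `|y - c| s by rewrite le_max lexx.
      have m2 : s <= Num.max `|y - c| s by rewrite le_max lexx orbT.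
      apply: powR_comparable => //; rewrite -/d in sx *; first by rewrite ler1n.
      + exact: lt_le_trans m2.
      + lra.
      + by rewrite ge_max; apply/andP; split; lra.
  under eq_integral do rewrite EFinM.
  rewrite ge0_integralZl//; last 2 first.
  - by apply/measurable_EFinP; exact: mker.
  - by rewrite lee_fin mulr_ge0 ?powR_ge0.
  rewrite [leRHS]EFinM lee_wpmul2l ?lee_fin ?mulr_ge0 ?powR_ge0//.
  exact: integral_kernel_ball_le.
have far : (\int[lebesgue_measure]_(y in D `\` N)
       (Num.max `|y - c| s `^ k * `|y - x| `^ (- al))%:E <=
     ((d / 2) `^ (- al) * (2 * s `^ (k + 1) + 2 * (G l - G s)))%:E)%E.
  apply: (@le_trans _ _ (\int[lebesgue_measure]_(y in D `\` N)
    ((d / 2) `^ (- al) * Num.max `|y - c| s `^ k)%:E)%E).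
    apply: ge0_le_integral => //.
    - exact: measurableD.
    - by move=> y _; rewrite lee_fin mulr_ge0 ?powR_ge0.
    - exact: mprod.
    - exact: mcmax.
    - move=> y /= [_ /negP yN]; rewrite lee_fin mulrC.
      rewrite ler_wpM2r ?powR_ge0// ler_npowR// ?oppr_le0 ?ltW//.
      by rewrite ltNge.
  under eq_integral do rewrite EFinM.
  rewrite ge0_integralZl//; last 4 first.
  - exact: measurableD.
  - by apply/measurable_EFinP; exact: mmax.
  - by move=> y _; rewrite lee_fin powR_ge0.
  - by rewrite lee_fin powR_ge0.
  rewrite [leRHS]EFinM lee_wpmul2l ?lee_fin ?powR_ge0//.
  by apply: integral_max_powR_le => //; [exact: measurableD|move=> y [/Dl]].
apply: le_trans (leeD near far) _.
(* The sign of this increment is read off from the annulus integral of a nonnegative function. *)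
have Gls : 0 <= G l - G s.
  have := integral_powR_annulus_le c s0 sl dG.
  have : (0 <= \int[lebesgue_measure]_(y in [set y | (s <= `|y - c| <= l)%R])
     (`|y - c| `^ k)%:E)%E.
    by apply: integral_ge0 => y _; rewrite lee_fin powR_ge0.
  by move=> /le_trans/[apply]; rewrite lee_fin pmulr_rge0.
rewrite -EFinD lee_fin.
have e1 : (d / 2) `^ (- al) <= 2 * d `^ (- al).
  have := @powR_comparable _ 2 (- al) d (d / 2); rewrite normrN gtr0_norm//.
  move=> h; apply: le_trans (h _ _ _ _ _) _; rewrite ?ler1n//; try lra.
  rewrite ler_wpM2r ?powR_ge0// -[leRHS]powRr1//.
  by rewrite ler_powR ?ler1n// ltW.
have e2 : (d / 2) `^ (1 - al) <= d `^ (- al) * d.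
  apply: (@le_trans _ _ (d `^ (1 - al))).
    by rewrite ler_ppowR//; lra.
  by rewrite addrC powR_add1.
have e3 : d `^ (k + 1) = d `^ k * d.
  by rewrite powR_add1.
rewrite e3.
set A := s `^ (k + 1); have A0 : 0 <= A by exact: powR_ge0.
set B := d `^ k; have B0 : 0 <= B by exact: powR_ge0.
set W := d `^ (- al); have W0 : 0 <= W by exact: powR_ge0.
have -> : 2 `^ `|k| * B * (2 * ((d / 2) `^ (1 - al) / (1 - al))) =
    K1 * B * (d / 2) `^ (1 - al) by rewrite /K1; field; lra.
have s1 : K1 * B * (d / 2) `^ (1 - al) <= K1 * W * (B * d).
  have -> : K1 * W * (B * d) = K1 * B * (W * d) by ring.
  by rewrite ler_wpM2l// mulr_ge0// ltW.
have s2 : (d / 2) `^ (- al) * (2 * A + 2 * (G l - G s)) <=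
    2 * W * (2 * A + 2 * (G l - G s)).
  by rewrite ler_wpM2r// addr_ge0// mulr_ge0.
have s3 : 0 <= K1 * W * (A + (G l - G s)).
  by apply: mulr_ge0; [exact: mulr_ge0 (ltW K10) W0|exact: addr_ge0].
have s4 : 0 <= W * (B * d) by apply: mulr_ge0 => //; exact: mulr_ge0 (ltW d0).
nra.
Qed.

(** * Mean value theorem, linear interpolation and the three rates *)

(** [s] and [t] come in either order, because the result is also applied to intermediate points
    whose order is unknown. *)
Lemma MVT_any (R : realType) (f : R -> R) (p q s t : R) :
  (forall x, p <= x <= q -> derivable f x 1) ->
  p <= s <= q -> p <= t <= q ->
  exists2 c, p <= c <= q & f t - f s = (f^`())%classic c * (t - s).
Proof.
move=> df.
wlog st : s t / s <= t => [wh ps pt|/andP[ps sq] /andP[pt tq]].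
  have [st|/ltW ts] := leP s t; first exact: wh.
  have [c pcq e] := wh _ _ ts pt ps; exists c => //.
  by rewrite -opprB e -mulrN opprB.
have dst x : s <= x <= t -> derivable f x 1.
  move=> /andP[sx xt]; apply: df.
  by rewrite (le_trans ps sx) (le_trans xt tq).
have [||c + e] := @MVT_segment R f (f^`())%classic s t st.
- move=> x; rewrite in_itv/= => /andP[sx xt].
  by rewrite derive1E; apply: DeriveDef => //; apply: dst; rewrite !ltW.
- apply: derivable_within_continuous => x; rewrite in_itv/=; exact: dst.
rewrite in_itv/= => /andP[sc ct]; exists c => //.
by rewrite (le_trans ps sc) (le_trans ct tq).
Qed.

(** Three mean values: the slope [A] is [u'] at some [x1], the chord of [u] from [p] to [y] has
    slope [u'] at some [x2], and the difference of the two slopes is [u''] times [x2 - x1]. The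
    constant 1 in place of the optimal 1/8 is enough for the rate. *)
Lemma linear_interpolation_error (R : realType) (u : R -> R) (p q A B M : R) :
  p < q ->
  (forall x, p <= x <= q -> derivable u x 1) ->
  (forall x, p <= x <= q -> derivable (u^`())%classic x 1) ->
  (forall x, p <= x <= q -> `|(u^`(2))%classic x| <= M) ->
  A * p + B = u p -> A * q + B = u q ->
  forall y, p <= y <= q -> `|u y - (A * y + B)| <= M * (q - p) ^+ 2.
Proof.
move=> pq du ddu uM ep eq y yin; have /andP[py yq] := yin.
have pin : p <= p <= q by rewrite lexx ltW.
have qin : p <= q <= q by rewrite lexx andbT ltW.
have M0 : 0 <= M by apply: le_trans (uM _ pin).
have [x1 x1in e1] := MVT_any du pin qin.
have [x2 x2in e2] := MVT_any du pin yin.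
have [x3 x3in e3] := MVT_any ddu x1in x2in.
have eA : A = (u^`())%classic x1.
  apply: (@mulIf _ (q - p)); first by rewrite subr_eq0 gt_eqF.
  by rewrite -e1 -ep -eq; ring.
have -> : u y - (A * y + B) = (u^`(2))%classic x3 * (x2 - x1) * (y - p).
  have -> : (u^`(2))%classic x3 * (x2 - x1) = (u^`())%classic x2 - A.
    by rewrite eA e3.
  have -> : u y = (u^`())%classic x2 * (y - p) + u p by rewrite -e2 subrK.
  by rewrite -ep; ring.
rewrite expr2 !normrM -mulrA; apply: ler_pM => //.
- exact: uM.
- apply: ler_pM => //.
    move: x1in x2in => /andP[? ?] /andP[? ?].
    by rewrite ler_norml; apply/andP; split; lra.
  by rewrite ger0_norm ?subr_ge0// lerD2r.
Qed.

(* The first component of the witness is the constant, the second one an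
   antiderivative of [s `^ (sigma - 2 / r)]: a power, or [ln] in the critical
   case. *)
Lemma error_rate_ge (R : realType) (r sigma L : R) : 0 < r -> 0 < L ->
  exists2 CG : R * (R -> R), 0 < CG.1 &
    (forall s : R, 0 < s -> is_derive s 1 CG.2 (s `^ (sigma - 2 / r))) /\
    forall (N : nat) (s d : R), (2 <= N)%N -> s = L * N%:R `^ (- r) ->
      s <= d <= 2 * L ->
      N%:R `^ (- 2) * (s `^ (sigma - 2 / r + 1)
         + (CG.2 (2 * L) - CG.2 s) + d `^ (sigma - 2 / r + 1))
      <= CG.1 * s * error_rate r sigma N.
Proof.
move=> r0 L0; pose q := sigma - 2 / r + 1.
have rq : r * q = r * (1 + sigma) - 2 by rewrite /q; field; rewrite gt_eqF.
have kq : sigma - 2 / r = q - 1 by rewrite /q addrK.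
rewrite -/q kq.
have Np (N : nat) : (2 <= N)%N -> 0 < (N%:R : R).
  by move=> N2; rewrite ltr0n (leq_trans _ N2).
have sp (N : nat) (s : R) : (2 <= N)%N -> s = L * N%:R `^ (- r) -> 0 < s.
  by move=> N2 ->; rewrite mulr_gt0// powR_gt0// Np.
have pD (N : nat) (x y : R) : (2 <= N)%N ->
    N%:R `^ (x + y) = N%:R `^ x * N%:R `^ y :> R.
  by move=> N2; rewrite powRD// (gt_eqF (Np N N2)) implybT.
have L20 : 0 < 2 * L by rewrite mulr_gt0.
rewrite /error_rate; have [p2|p2|p2] := ltgtP 2 (r * (1 + sigma)).
- have q0 : 0 < q by rewrite -(pmulr_rgt0 _ r0) rq subr_gt0.
  (* For [q > 0] all powers are at most [(2 * L) ^ q]: the 2 accounts for [s ^ q] and [d ^ q], and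
     [q^-1] for the integral. *)
  pose M := (2 * L) `^ q * (2 + q^-1).
  exists (M / L, fun s => s `^ q / q) => /=.
    by rewrite divr_gt0 ?mulr_gt0 ?powR_gt0 ?addr_gt0 ?invr_gt0.
  split=> [s s0|N s d N2 es /andP[sd dL]].
    by apply: is_derive_powR_primitive => //; rewrite gt_eqF.
  have s0 := sp _ _ N2 es; have d0 := lt_le_trans s0 sd.
  have -> : M / L * s * N%:R `^ (r - 2) = N%:R `^ (- 2) * M.
    rewrite es [r - 2]addrC pD// powRN; field.
    by rewrite !gt_eqF ?powR_gt0// Np.
  rewrite ler_wpM2l ?powR_ge0//.
  have h1 : d `^ q <= (2 * L) `^ q by rewrite ler_ppowR// ltW.
  have h2 : s `^ q <= d `^ q by rewrite ler_ppowR// ltW.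
  have h3 : 0 <= s `^ q / q by rewrite divr_ge0 ?powR_ge0// ltW.
  rewrite /M; lra.
- have q0 : q < 0 by rewrite -(pmulr_rlt0 _ r0) rq subr_lt0.
  (* For [q < 0] the power [s ^ q] dominates: it counts twice for the two powers and [- q^-1] times
     for the antiderivative at [s]. *)
  pose M := L `^ q * (2 - q^-1).
  have M0 : 0 < M by rewrite mulr_gt0 ?powR_gt0// ltr_wpDl// oppr_gt0 invr_lt0.
  exists (M / L, fun s => s `^ q / q) => /=; first by rewrite divr_gt0.
  split=> [s s0|N s d N2 es /andP[sd dL]].
    by apply: is_derive_powR_primitive => //; rewrite lt_eqF.
  have s0 := sp _ _ N2 es; have d0 := lt_le_trans s0 sd.
  have eq : s `^ q = L `^ q * (N%:R `^ 2 * N%:R `^ (- r) * N%:R `^ (- (r * sigma))).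
    rewrite es powRM ?powR_ge0 ?(ltW L0)// -powRrM -!pD//; congr (_ * _ `^ _).
    by rewrite mulNr rq; ring.
  have -> : M / L * s * N%:R `^ (- (r * sigma)) = N%:R `^ (- 2) * (s `^ q * (2 - q^-1)).
    rewrite eq es /M (powRN _ 2); field.
    by rewrite (lt_eqF q0) !gt_eqF ?powR_gt0 ?Np.
  rewrite ler_wpM2l ?powR_ge0//.
  have h1 : d `^ q <= s `^ q by rewrite ler_npowR// ltW.
  have h3 : (2 * L) `^ q / q <= 0.
    by rewrite mulr_ge0_le0 ?powR_ge0// ltW// invr_lt0.
  lra.
- have q0 : q = 0 by apply: (@mulfI _ r); rewrite ?gt_eqF// rq -p2 subrr mulr0.
  (* For [q = 0] both powers are 1, and their sum is at most [2 / ln 2 * ln N] as [N >= 2]; the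
     integral [ln 2 + r * ln N] accounts for [1 + r]. *)
  pose M : R := 2 / ln 2 + 1 + r.
  have ln2 : 0 < ln (2 : R) by rewrite ln_gt0// ltr1n.
  have M0 : 0 < M by rewrite !addr_gt0// divr_gt0.
  exists (M / L, @ln R) => /=; first by rewrite divr_gt0.
  split=> [s s0|N s d N2 es /andP[sd dL]].
    by rewrite q0 sub0r powR_inv1 ?(ltW s0)//; exact: is_derive1_ln.
  have s0 := sp _ _ N2 es; have d0 := lt_le_trans s0 sd.
  have -> : M / L * s * (N%:R `^ (r - 2) * ln N%:R) = N%:R `^ (- 2) * (M * ln N%:R).
    rewrite es [r - 2]addrC pD// powRN; field.
    by rewrite !gt_eqF ?powR_gt0// Np.
  rewrite ler_wpM2l ?powR_ge0// q0 !powRr0.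
  have -> : ln (2 * L) = ln 2 + ln L by rewrite lnM ?posrE.
  have -> : ln s = ln L - r * ln N%:R.
    by rewrite es lnM ?posrE ?powR_gt0 ?Np// ln_powR mulNr.
  have h : ln 2 <= ln N%:R :> R by rewrite ler_ln ?posrE ?Np// ler_nat.
  have h2 : 2 <= 2 / ln 2 * ln N%:R :> R by rewrite mulrAC ler_pdivlMr// ler_pM2l.
  rewrite /M; lra.
Qed.

(** * Interpolation error on a piece away from the endpoints *)

Lemma affine_between (R : realType) (p q A B y lo hi : R) : p < q ->
  p <= y <= q -> lo <= A * p + B <= hi -> lo <= A * q + B <= hi ->
  lo <= A * y + B <= hi.
Proof.
move=> pq /andP[py yq] /andP[lp hp] /andP[lq hq].
have qp0 : 0 < q - p by rewrite subr_gt0.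
have e : (q - p) * (A * y + B) = (q - y) * (A * p + B) + (y - p) * (A * q + B).
  by ring.
have yp0 : 0 <= y - p by rewrite subr_ge0.
have qy0 : 0 <= q - y by rewrite subr_ge0.
have h1 := ler_wpM2l qy0 lp; have h2 := ler_wpM2l qy0 hp.
have h3 := ler_wpM2l yp0 lq; have h4 := ler_wpM2l yp0 hq.
by rewrite -(ler_pM2l qp0) -[X in _ && X](ler_pM2l qp0) e; apply/andP; split; lra.
Qed.

(** Covers both halves of the mesh: [c] stands for the endpoint of the half and [n] for the number
    of steps between [c] and the piece, at distance [d = L * (n / N) ^ r]. The second derivative is
    at most [C0 * (d * L) ^ (sigma - 2)] and the step at most [K * d / n]; then
    [(n / N) ^ 2 = (d / L) ^ (2 / r)] trades [n ^ (- 2)] for [N ^ (- 2)] and produces the exponent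
    [sigma - 2 / r]. *)
Lemma interior_piece_error (R : realType) (a b sigma r C0 K : R) (u : R -> R) :
  a < b -> 0 < r -> sigma < 1 -> 0 <= C0 -> 1 <= K ->
  is_C2_on a b u ->
  (forall x, a < x < b ->
     `|(u^`(2))%classic x| <= C0 * ((x - a) * (b - x)) `^ (sigma - 2)) ->
  (forall n N : nat, (0 < n)%N -> (0 < N)%N ->
    (n.+1%:R / N%:R) `^ r <= (1 + K / n%:R) * (n%:R / N%:R) `^ r) ->
  forall (n N : nat) (p q c A B : R), (0 < n)%N -> (0 < N)%N ->
    a < p -> p < q -> q < b ->
    q - p = (b - a) / 2 * (n.+1%:R / N%:R) `^ r
            - (b - a) / 2 * (n%:R / N%:R) `^ r ->
    (forall z, p <= z <= q ->
       (b - a) / 2 * (n%:R / N%:R) `^ r <= `|z - c|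
         <= (b - a) / 2 * (n%:R / N%:R) `^ r + (q - p)
       /\ (b - a) / 2 * (n%:R / N%:R) `^ r * ((b - a) / 2) <= (z - a) * (b - z)) ->
    A * p + B = u p -> A * q + B = u q ->
    forall y, p <= y <= q ->
    `|u y - (A * y + B)| <=
      C0 * ((b - a) / 2) `^ (sigma - 2) * ((b - a) / 2) `^ (2 / r) * K ^+ 2
      * (1 + K) `^ `|sigma - 2 / r| * N%:R `^ (- 2)
      * Num.max `|y - c| ((b - a) / 2 * N%:R `^ (- r)) `^ (sigma - 2 / r).
Proof.
move=> ab r0 sigma1 C00 K1 C2 bnd step n N p q c A B n0 N0 ap pq qb.
set L := (b - a) / 2; set t := n%:R / N%:R; set d := L * t `^ r.
have L0 : 0 < L by rewrite divr_gt0// subr_gt0.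
have n0' : 0 < n%:R :> R by rewrite ltr0n.
have N0' : 0 < N%:R :> R by rewrite ltr0n.
have t0 : 0 < t by rewrite divr_gt0.
have d0 : 0 < d by rewrite mulr_gt0// powR_gt0.
have K0 : 0 < K by exact: lt_le_trans K1.
move=> eh dist ep eq y yin.
have h_le : q - p <= K / n%:R * d.
  rewrite eh lerBlDr -/d -{2}[d]mul1r -mulrDl addrC.
  rewrite /d mulrCA ler_wpM2l ?(ltW L0)//; exact: step.
have inab x : p <= x <= q -> a < x < b.
  by move=> /andP[px xq]; rewrite (lt_le_trans ap px) (le_lt_trans xq qb).
have err : `|u y - (A * y + B)| <= C0 * (d * L) `^ (sigma - 2) * (q - p) ^+ 2.
  apply: linear_interpolation_error ep eq y yin => // x xin.
  - by have [] := C2 _ (inab _ xin).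
  - by have [] := C2 _ (inab _ xin).
  - apply: le_trans (bnd _ (inab _ xin)) _; rewrite ler_wpM2l//.
    have [_ h] := dist _ xin; apply: ler_npowR => //; last by rewrite mulr_gt0.
    lra.
apply: le_trans err _.
have sq : (q - p) ^+ 2 <= (K / n%:R * d) ^+ 2.
  by rewrite ler_sqr ?nnegrE ?subr_ge0 ?(ltW pq)// mulr_ge0// ?divr_ge0// ltW.
have [/andP[dy1 dy2] _] := dist _ yin; rewrite -/t -/L -/d in dy1 dy2.
set m := Num.max _ _.
(* Since [n >= 1], the piece is at least one first step away from [c], and the truncation is
   inactive. *)
have me : m = `|y - c|.
  rewrite /m max_l//; apply: le_trans dy1; rewrite /d ler_wpM2l ?(ltW L0)//.
  rewrite powRN -[leLHS]mul1r -ler_pdivlMr ?invr_gt0 ?powR_gt0// invrK.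
  rewrite -powRM ?(ltW t0) ?(ltW N0')// /t divfK ?gt_eqF//.
  have n1 : 1 <= n%:R :> R by rewrite ler1n.
  by have := ler_ppowR (ltW r0) (@ler01 R) n1; rewrite powR1.
have m0 : 0 < m by rewrite me; exact: lt_le_trans dy1.
have Kn : K / n%:R <= K by rewrite ler_pdivrMr// ler_peMr ?ler1n// ltW.
(* Distances to [c] on the piece lie between [d] and [(1 + K) * d], because the step is at most
   [K * d]. *)
have cmp : d `^ (sigma - 2 / r) <= (1 + K) `^ `|sigma - 2 / r| * m `^ (sigma - 2 / r).
  apply: powR_comparable => //; first by rewrite lerDl ltW.
    rewrite me (le_trans dy2)// mulrDl mul1r lerD2l (le_trans h_le)//.
    by rewrite ler_wpM2r// ltW.
  rewrite -me in dy1; have Km : 0 <= K * m by rewrite mulr_ge0// ltW.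
  lra.
have dk : d `^ (sigma - 2 / r) = d `^ sigma / (L `^ (2 / r) * t ^+ 2).
  rewrite powRB ?(gt_eqF d0) ?implybT//; congr (_ / _).
  rewrite /d powRM ?powR_ge0 ?(ltW L0)//; congr (_ * _).
  rewrite -powRrM mulrCA divff ?gt_eqF// mulr1 -powR_mulrn ?(ltW t0)//.
have ds : d `^ (sigma - 2) = d `^ sigma / d ^+ 2.
  by rewrite powRB ?(gt_eqF d0) ?implybT// -powR_mulrn// ltW.
apply: (@le_trans _ _ (C0 * L `^ (sigma - 2) * L `^ (2 / r) * K ^+ 2
    * N%:R `^ (- 2) * d `^ (sigma - 2 / r))).
  apply: (@le_trans _ _ (C0 * (d * L) `^ (sigma - 2) * (K / n%:R * d) ^+ 2)).
    by rewrite ler_wpM2l// mulr_ge0// powR_ge0.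
  rewrite le_eqVlt; apply/orP; left; apply/eqP.
  rewrite powRM ?(ltW L0) ?(ltW d0)// dk ds (powRN _ 2).
  rewrite -[2]/(2%:R) (powR_mulrn 2) ?(ltW N0')// /t.
  set X := d `^ sigma; set Y := L `^ _; set Z := L `^ _.
  have Z0 : 0 < Z by rewrite powR_gt0.
  by field; rewrite !gt_eqF.
set P := C0 * _ * _ * _.
have P0 : 0 <= P.
  apply: mulr_ge0; last exact: sqr_ge0.
  by do 2 (apply: mulr_ge0; last exact: powR_ge0).
move: P P0 => P P0; rewrite -!mulrA ler_wpM2l//.
by rewrite [leRHS]mulrCA ler_wpM2l ?powR_ge0.
Qed.

(** * The graded mesh *)

Lemma mesh_left (R : realType) (a b r : R) (N j : nat) : (j <= N)%N ->
  mesh a b r N j = a + (b - a) / 2 * (j%:R / N%:R) `^ r.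
Proof. by rewrite /mesh => ->. Qed.

(** Counting steps from [b] makes the right half a mirror image of the left one. The case [j = N] is
    included: both branches of [mesh] give the midpoint there. *)
Lemma mesh_right (R : realType) (a b r : R) (N j : nat) :
  (0 < N)%N -> (N <= j)%N -> (j <= 2 * N)%N ->
  mesh a b r N j = b - (b - a) / 2 * ((2 * N - j)%:R / N%:R) `^ r.
Proof.
move=> N0 Nj j2N; have N0' : N%:R != 0 :> R by rewrite pnatr_eq0 -lt0n.
have e : (2 * N - j)%:R / N%:R = 2 - j%:R / N%:R :> R.
  by rewrite natrB// natrM; field.
rewrite /mesh e; case: ifPn => // jN.
have -> : j = N by apply/eqP; rewrite eqn_leq jN.
rewrite divff// (_ : 2 - 1 = 1); last by ring.
by rewrite powR1; field.
Qed.

Lemma mesh_first (R : realType) (a b r : R) (N : nat) : 0 < r ->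
  mesh a b r N 0 = a.
Proof. by move=> r0; rewrite mesh_left// mul0r powR0 ?gt_eqF// mulr0 addr0. Qed.

Lemma mesh_last (R : realType) (a b r : R) (N : nat) : 0 < r -> (0 < N)%N ->
  mesh a b r N (2 * N) = b.
Proof.
move=> r0 N0; rewrite mesh_right ?leq_pmull// subnn mul0r powR0 ?gt_eqF//.
by rewrite mulr0 subr0.
Qed.

Lemma mesh_ltS (R : realType) (a b r : R) (N j : nat) : a < b -> 0 < r ->
  (j < 2 * N)%N -> mesh a b r N j < mesh a b r N j.+1.
Proof.
move=> ab r0 j2N; have N0 : (0 < N)%N by case: N j2N => //; rewrite muln0.
have L0 : 0 < (b - a) / 2 by rewrite divr_gt0// subr_gt0.
have lt (i k : nat) : (i < k)%N ->
    ((i%:R / N%:R) `^ r < (k%:R / N%:R) `^ r :> R).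
  move=> ik; apply: (gt0_ltr_powR r0); rewrite ?nnegrE ?divr_ge0 ?ler0n//.
  by rewrite ltr_pM2r ?invr_gt0 ?ltr0n// ltr_nat.
have [jN|Nj] := ltnP j N.
  by rewrite (mesh_left _ _ _ (ltnW jN)) (mesh_left _ _ _ jN) ltrD2l ltr_pM2l// lt.
rewrite !mesh_right// ?(ltnW j2N)// ?(leqW Nj)// ltrD2l ltrN2 ltr_pM2l//.
by apply: lt; rewrite subnS prednK// subn_gt0.
Qed.

Lemma mesh_le (R : realType) (a b r : R) (N i j : nat) : a < b -> 0 < r ->
  (i <= j)%N -> (j <= 2 * N)%N -> mesh a b r N i <= mesh a b r N j.
Proof.
move=> ab r0; elim: j => [|j IH]; first by rewrite leqn0 => /eqP ->.
rewrite leq_eqVlt => /predU1P[->//|]; rewrite ltnS => ij j2N.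
exact: le_trans (IH ij (ltnW j2N)) (ltW (mesh_ltS ab r0 j2N)).
Qed.

Lemma mesh_lt (R : realType) (a b r : R) (N i j : nat) : a < b -> 0 < r ->
  (i < j)%N -> (j <= 2 * N)%N -> mesh a b r N i < mesh a b r N j.
Proof.
move=> ab r0 ij j2N.
by rewrite (lt_le_trans (mesh_ltS ab r0 (leq_trans ij j2N)))// mesh_le.
Qed.

Lemma mesh_locate (R : realType) (a b r : R) (N : nat) (y : R) :
  0 < r -> (0 < N)%N -> a <= y <= b ->
  exists2 k : nat, (k < 2 * N)%N & mesh a b r N k <= y <= mesh a b r N k.+1.
Proof.
move=> r0 N0 /andP[ay yb].
have : forall m, (m.+1 <= 2 * N)%N -> y <= mesh a b r N m.+1 ->
    exists2 k : nat, (k < 2 * N)%N & mesh a b r N k <= y <= mesh a b r N k.+1.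
  elim=> [|m IH] m2N ym; first by exists 0%N => //; rewrite mesh_first// ay.
  have [ym'|my] := leP y (mesh a b r N m.+1); first exact: IH (ltnW m2N) ym'.
  by exists m.+1 => //; rewrite (ltW my).
have N20 : (0 < 2 * N)%N by rewrite muln_gt0.
by move=> /(_ (2 * N).-1); rewrite prednK// mesh_last//; apply.
Qed.

(** * Combinations of the interior hats *)

Lemma interior_index (N : nat) (i : 'I_(2 * N).-1) : (i.+1 < 2 * N)%N.
Proof. by rewrite -ltn_predRL. Qed.

(* The end hats are left out: the interpolated values vanish at [a] and [b]. *)
Definition interior_comb (R : realType) (N : nat) (phi : nat -> R -> R)
  (v : nat -> R) (y : R) := \sum_(i < (2 * N).-1) v i.+1 * phi i.+1 y.

Lemma interior_comb_node (R : realType) (a b r : R) (N : nat)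
    (phi : nat -> R -> R) (v : nat -> R) (k : nat) :
  hat_functions a b r N phi -> v 0%N = 0 -> v (2 * N)%N = 0 ->
  (k <= 2 * N)%N -> interior_comb N phi v (mesh a b r N k) = v k.
Proof.
move=> hat v0 v2N k2N; rewrite /interior_comb.
have e (i : 'I_(2 * N).-1) : v i.+1 * phi i.+1 (mesh a b r N k) =
    if i.+1 == k then v k else 0.
  have i2N : (i.+1 <= 2 * N)%N.
    by rewrite ltnW// interior_index.
  have [_ _ ->//] := hat _ i2N.
  by case: eqP => [->|_]; rewrite ?mulr1 ?mulr0.
rewrite (eq_bigr _ (fun i _ => e i)) -big_mkcond/=.
case: k k2N {e} => [|k] k2N; first by rewrite big_pred0.
have [k2|k2] := eqVneq k.+1 (2 * N)%N.
  rewrite k2 v2N big1//.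
have kI : (k < (2 * N).-1)%N.
  have : (k.+1 < 2 * N)%N by rewrite ltn_neqAle k2.
  by case: (2 * N)%N.
by rewrite (big_pred1 (Ordinal kI)).
Qed.

Lemma interior_comb_affine (R : realType) (a b r : R) (N : nat)
    (phi : nat -> R -> R) (v : nat -> R) (k : nat) :
  hat_functions a b r N phi -> (k < 2 * N)%N ->
  exists A B : R, forall y, mesh a b r N k <= y <= mesh a b r N k.+1 ->
    interior_comb N phi v y = A * y + B.
Proof.
move=> hat k2N; rewrite /interior_comb.
(* The coefficients of each hat come from an existential, so they are accumulated along a list of
   indices. *)
have : forall s : seq 'I_(2 * N).-1, exists A B : R, forall y,
    mesh a b r N k <= y <= mesh a b r N k.+1 ->
    \sum_(i <- s) v i.+1 * phi i.+1 y = A * y + B.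
  elim=> [|i s [A [B IH]]].
    by exists 0, 0 => y _; rewrite big_nil mul0r addr0.
  have i2N : (i.+1 <= 2 * N)%N.
    by rewrite ltnW// interior_index.
  have [_ + _] := hat _ i2N; move=> /(_ k.+1 k2N)/= [p [q pq]].
  exists (v i.+1 * p + A), (v i.+1 * q + B) => y yin.
  by rewrite big_cons IH// pq//; ring.
by move=> /(_ (index_enum _)).
Qed.

Lemma interior_comb_measurable (R : realType) (a b r : R) (N : nat)
    (phi : nat -> R -> R) (v : nat -> R) : hat_functions a b r N phi ->
  measurable_fun `[a, b]%classic (interior_comb N phi v).
Proof.
move=> hat; apply: measurable_sum => i; apply: measurable_funM => //.
have i2N : (i.+1 <= 2 * N)%N.
  by rewrite ltnW// interior_index.
have [cphi _ _] := hat _ i2N.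
exact: subspace_continuous_measurable_fun.
Qed.

(** The combination is affine on each piece, so its extreme values are nodal. *)
Lemma interior_comb_between (R : realType) (a b r lo hi : R) (N : nat)
    (phi : nat -> R -> R) (v : nat -> R) :
  a < b -> 0 < r -> (0 < N)%N ->
  hat_functions a b r N phi -> v 0%N = 0 -> v (2 * N)%N = 0 ->
  (forall k, (k <= 2 * N)%N -> lo <= v k <= hi) ->
  forall y, a <= y <= b -> lo <= interior_comb N phi v y <= hi.
Proof.
move=> ab r0 N0 hat v0 v2N vb y yab.
have [k k2N yk] := mesh_locate r0 N0 yab.
have [A [B e]] := interior_comb_affine v hat k2N.
have pq := mesh_ltS ab r0 k2N; rewrite e//.
apply: (affine_between pq yk); rewrite -e ?lexx ?(ltW pq)//;
  rewrite (interior_comb_node hat)//; by [exact: vb|exact/vb/ltnW|exact: ltnW].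
Qed.

(** * Interpolation error on the whole interval *)

(** In the left half the distance to the right endpoint [a + 2 * L] is at least [L]. This supplies
    the distance hypotheses of [interior_piece_error] with [c = a]. *)
Lemma left_piece_geometry (R : realType) (a L p q z : R) :
  0 < L -> a < p -> p <= z <= q -> q <= a + L ->
  p - a <= `|z - a| <= p - a + (q - p) /\
  (p - a) * L <= (z - a) * (a + 2 * L - z).
Proof.
move=> L0 ap /andP[pz zq] qL; rewrite ger0_norm; last by lra.
split; first by apply/andP; split; lra.
by apply: ler_pM; lra.
Qed.

Lemma right_piece_geometry (R : realType) (b L p q z : R) :
  0 < L -> q < b -> p <= z <= q -> b - L <= p ->
  b - q <= `|z - b| <= b - q + (q - p) /\
  (b - q) * L <= (z - (b - 2 * L)) * (b - z).
Proof.
move=> L0 ap /andP[pz zq] qL; rewrite ler0_norm; last by lra.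
split; first by apply/andP; split; lra.
by rewrite [leRHS]mulrC; apply: ler_pM; lra.
Qed.

(** Pieces of the left half are measured from [a] and those of the right half from [b]. Adding the
    two weights gives the bound one form on all of [[a, b]], and each weight can later be integrated
    against the kernel separately. *)
Lemma interpolation_error (R : realType) (a b sigma r C0 : R) (u : R -> R) :
  a < b -> 0 < r -> 0 < sigma < 1 -> is_C2_on a b u ->
  (forall (l : nat) (x : R), (l <= 2)%N -> a < x < b ->
     `|(u^`(l))%classic x| <= C0 * ((x - a) * (b - x)) `^ (sigma - l%:R)) ->
  u a = 0 -> u b = 0 ->
  exists2 K : R, 0 <= K & forall (N : nat) (phi : nat -> R -> R) (y : R),
    (0 < N)%N -> hat_functions a b r N phi -> a <= y <= b ->
    `|u y - interior_comb N phi (fun k => u (mesh a b r N k)) y| <=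
      K * N%:R `^ (- 2) *
        (Num.max `|y - a| ((b - a) / 2 * N%:R `^ (- r)) `^ (sigma - 2 / r)
       + Num.max `|y - b| ((b - a) / 2 * N%:R `^ (- r)) `^ (sigma - 2 / r)).
Proof.
move=> ab r0 /andP[sigma0 sigma1] C2 bnd ua ub.
have [K K1 step] := powR_step r0.
pose L := (b - a) / 2; have L0 : 0 < L by rewrite divr_gt0// subr_gt0.
have bL : b = a + 2 * L by rewrite /L; field.
have C00 : 0 <= C0.
  have mab : a < a + L < b by rewrite bL; apply/andP; split; lra.
  have := le_trans (normr_ge0 _) (bnd 0%N _ isT mab).
  rewrite pmulr_lge0// powR_gt0// mulr_gt0// subr_gt0; lra.
pose Ki := C0 * L `^ (sigma - 2) * L `^ (2 / r) * K ^+ 2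
      * (1 + K) `^ `|sigma - 2 / r|.
pose Kb := 2 * C0 * (2 * L) `^ sigma * L `^ (2 / r).
have Ki0 : 0 <= Ki.
  apply: mulr_ge0; last exact: powR_ge0.
  apply: mulr_ge0; last exact: sqr_ge0.
  by do 2 (apply: mulr_ge0; last exact: powR_ge0).
have Kb0 : 0 <= Kb by rewrite /Kb !mulr_ge0 ?powR_ge0.
(* [Ki] bounds the error on the inner pieces and [Kb] on the two end pieces,
   where [u''] may be unbounded and only the size of [u] is used. *)
exists (Ki + Kb); first exact: addr_ge0.
move=> N phi y N0 hat yab.
set v := fun k => _.
have v0 : v 0%N = 0 by rewrite /v mesh_first.
have v2N : v (2 * N)%N = 0 by rewrite /v mesh_last.
rewrite -/L; set s := L * N%:R `^ (- r).
have N0' : 0 < N%:R :> R by rewrite ltr0n.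
have s0 : 0 < s by rewrite mulr_gt0// powR_gt0.
have s1E : L * (1%:R / N%:R) `^ r = s.
  by rewrite /s div1r powRN -powR_inv1 ?ltW// -powRrM mulN1r powRN.
set ma := Num.max _ _ `^ _; set mb := Num.max _ _ `^ _.
have ma0 : 0 <= ma by exact: powR_ge0.
have mb0 : 0 <= mb by exact: powR_ge0.
have final (c K' : R) : c = a \/ c = b -> 0 <= K' -> K' <= Ki + Kb ->
   `|u y - interior_comb N phi v y| <=
     K' * N%:R `^ (- 2) * Num.max `|y - c| s `^ (sigma - 2 / r) ->
   `|u y - interior_comb N phi v y| <= (Ki + Kb) * N%:R `^ (- 2) * (ma + mb).
  move=> cab K'0 K'K /le_trans; apply.
  apply: ler_pM; rewrite ?mulr_ge0 ?powR_ge0//.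
    by rewrite ler_wpM2r ?powR_ge0.
  by case: cab => ->; rewrite -/ma -/mb ?lerDl ?lerDr.
have [k k2N yk] := mesh_locate r0 N0 yab.
have [A [B e]] := interior_comb_affine v hat k2N.
have pq := mesh_ltS ab r0 k2N; have le_pq := ltW pq.
have ep : A * mesh a b r N k + B = u (mesh a b r N k).
  by rewrite -e ?lexx// (interior_comb_node hat)//; exact: ltnW.
have eq : A * mesh a b r N k.+1 + B = u (mesh a b r N k.+1).
  by rewrite -e ?lexx ?andbT// (interior_comb_node hat).
have pa : a <= mesh a b r N k.
  by rewrite -[leLHS](mesh_first a b N r0) mesh_le// ltnW.
have qb : mesh a b r N k.+1 <= b.
  by rewrite -[leRHS](mesh_last a b r0 N0) mesh_le.
have midE : mesh a b r N N = a + L.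
  by rewrite mesh_left// divff ?gt_eqF// powR1 mulr1.
have boundary c : c = a \/ c = b ->
    (forall z, mesh a b r N k <= z <= mesh a b r N k.+1 -> `|z - c| <= s) ->
    `|u y - (A * y + B)| <=
      Kb * N%:R `^ (- 2) * Num.max `|y - c| s `^ (sigma - 2 / r).
  move=> cab cs; rewrite max_r; last exact: cs.
  (* An end piece has length [s], so [(z - a) * (b - z)] is at most [s * (2 * L)] there, and [T]
     bounds [u] and hence its interpolant. The sum [2 * T] has the required form because
     [s ^ (2 / r) = L ^ (2 / r) * N ^ (- 2)]. *)
  pose T := C0 * (s * (2 * L)) `^ sigma.
  have uT z : mesh a b r N k <= z <= mesh a b r N k.+1 -> `|u z| <= T.
    move=> zpq; have zs := cs _ zpq.
    have /andP[zp zq] := zpq.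
    have za : a <= z by exact: le_trans zp.
    have zb : z <= b by exact: le_trans qb.
    have T0 : 0 <= T by rewrite mulr_ge0// powR_ge0.
    have [->|za'] := eqVneq z a; first by rewrite ua normr0.
    have [->|zb'] := eqVneq z b; first by rewrite ub normr0.
    have zin : a < z < b by rewrite lt_neqAle eq_sym za' za lt_neqAle zb' zb.
    apply: le_trans (bnd 0%N z isT zin) _; rewrite subr0 ler_wpM2l//.
    apply: ler_ppowR; rewrite ?(ltW sigma0)//.
      by rewrite mulr_ge0// subr_ge0.
    case: cab zs => ->.
      rewrite ger0_norm ?subr_ge0// => zs.
      by apply: ler_pM; rewrite ?subr_ge0//; rewrite bL; lra.
    rewrite ler0_norm ?subr_le0// opprB => zs.
    rewrite mulrC; apply: ler_pM; rewrite ?subr_ge0//; move: zb; rewrite bL; lra.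
  have pin : mesh a b r N k <= mesh a b r N k <= mesh a b r N k.+1.
    by rewrite lexx le_pq.
  have qin : mesh a b r N k <= mesh a b r N k.+1 <= mesh a b r N k.+1.
    by rewrite lexx le_pq.
  have h1 : - T <= A * y + B <= T.
    by apply: (affine_between pq yk); rewrite ?ep ?eq -ler_norml uT.
  have -> : Kb * N%:R `^ (- 2) * s `^ (sigma - 2 / r) = 2 * T.
    have L20 : 0 <= 2 * L by rewrite mulr_ge0// ltW.
    have s0' := ltW s0.
    rewrite /T (@powRM _ s (2 * L) sigma)//.
    rewrite (@powRB _ s sigma (2 / r)) ?(gt_eqF s0) ?implybT//.
    have -> : s `^ (2 / r) = L `^ (2 / r) * N%:R `^ (- 2).
      rewrite /s powRM ?powR_ge0 ?(ltW L0)// -powRrM; congr (_ * _ `^ _).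
      by field; rewrite gt_eqF.
    rewrite /Kb; field.
    by rewrite !gt_eqF ?powR_gt0.
  rewrite (le_trans (ler_normB _ _))// mulr_natl mulr2n lerD ?uT//.
  by rewrite ler_norml.
have [k0|k0] := posnP k.
  apply: (final a Kb) => //; [by left|by rewrite lerDr|rewrite e//].
  apply: boundary => [|z]; first by left.
  rewrite {1 2}k0 mesh_first// mesh_left// s1E => /andP[az zs].
  by rewrite ger0_norm ?subr_ge0// lerBlDl.
have [k2|k2] := eqVneq k.+1 (2 * N)%N.
  apply: (final b Kb) => //; [by right|by rewrite lerDr|rewrite e//].
  apply: boundary => [|z]; first by right.
  have kE : k = (2 * N).-1 by rewrite -k2.
  rewrite k2 mesh_last// mesh_right ?(ltnW k2N)//; last first.
    by rewrite -ltnS k2 mul2n -addnn -[ltnLHS]addn0 ltn_add2l.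
  have -> : (2 * N - k)%N = 1%N by rewrite -k2 subSnn.
  rewrite s1E => /andP[zs zb].
  by rewrite ler0_norm ?subr_le0// opprB lerBlDl -lerBlDr.
have ap : a < mesh a b r N k.
  by rewrite -[ltLHS](mesh_first a b N r0) mesh_lt// ltnW.
have qb' : mesh a b r N k.+1 < b.
  by rewrite -[ltRHS](mesh_last a b r0 N0) mesh_lt// ltn_neqAle k2.
have bnd2 x : a < x < b ->
    `|(u^`(2))%classic x| <= C0 * ((x - a) * (b - x)) `^ (sigma - 2).
  exact: bnd.
have [kN|Nk] := ltnP k N.
  apply: (final a Ki) => //; [by left|by rewrite lerDl|rewrite e//].
  have pE := mesh_left a b r (ltnW kN); have qE := mesh_left a b r kN.
  apply: (interior_piece_error ab r0 sigma1 C00 K1 C2 bnd2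
    step k0 N0 ap pq qb' _ _ ep eq yk).
    by rewrite pE qE; ring.
  rewrite -/L => z zin.
  have pE' : L * (k%:R / N%:R) `^ r = mesh a b r N k - a.
    by rewrite pE -/L; ring.
  have qm : mesh a b r N k.+1 <= a + L by rewrite -midE mesh_le// mul2n -addnn leq_addr.
  rewrite pE'.
  have -> : (z - a) * (b - z) = (z - a) * (a + 2 * L - z) by rewrite -bL.
  exact: left_piece_geometry.
apply: (final b Ki) => //; [by right|by rewrite lerDl|rewrite e//].
(* On the right half the node closer to the endpoint is the right one, so [2 * N - k.+1] plays the
   role of [n]. *)
have n0 : (0 < 2 * N - k.+1)%N by rewrite subn_gt0 ltn_neqAle k2.
have pE := mesh_right a b r N0 Nk (ltnW k2N).
have qE := mesh_right a b r N0 (leqW Nk) k2N.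
have nS : (2 * N - k)%N = (2 * N - k.+1).+1 by rewrite subnSK.
rewrite nS in pE.
apply: (interior_piece_error ab r0 sigma1 C00 K1 C2 bnd2
    step n0 N0 ap pq qb' _ _ ep eq yk).
  by rewrite pE qE; ring.
rewrite -/L => z zin.
have qE' : L * ((2 * N - k.+1)%:R / N%:R) `^ r = b - mesh a b r N k.+1.
  by rewrite qE -/L; ring.
have pm : b - L <= mesh a b r N k.
  have -> : b - L = a + L by rewrite /L; field.
  by rewrite -midE mesh_le// ltnW.
have aL : a = b - 2 * L by rewrite /L; field.
rewrite qE'.
have -> : (z - a) * (b - z) = (z - (b - 2 * L)) * (b - z) by rewrite -aL.
exact: right_piece_geometry.
Qed.

(** * Integrability and the discrete maximum principle *)

(** Integrability of the partial sums is carried along, since additivity of the integral requires it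
    in the induction step. *)
Lemma Rintegral_sum (d : measure_display) (T : measurableType d) (R : realType)
    (mu : {measure set T -> \bar R}) (D : set T) (I : Type) (s : seq I)
    (F : I -> T -> R) : measurable D ->
  (forall i, mu.-integrable D (EFin \o F i)) ->
  mu.-integrable D (EFin \o (fun y => \sum_(i <- s) F i y)) /\
  \sum_(i <- s) \int[mu]_(y in D) F i y
    = \int[mu]_(y in D) \sum_(i <- s) F i y.
Proof.
move=> mD iF; elim: s => [|i s [IH1 IH2]].
  rewrite big_nil; split.
    apply: eq_integrable (integrable0 mu D) => // y _ /=.
    by rewrite big_nil.
  under eq_Rintegral do rewrite big_nil.
  by rewrite Rintegral_cst// mul0r.
split.
  apply: eq_integrable (integrableD mD (iF i) IH1) => // y _ /=.
  by rewrite big_cons EFinD.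
rewrite big_cons IH2 -RintegralD//.
by apply: eq_Rintegral => y _; rewrite big_cons.
Qed.

Lemma integrable_bounded_kernel (R : realType) (al x a b M : R) (g : R -> R) :
  0 < al < 1 -> measurable_fun `[a, b]%classic g ->
  (forall y, a <= y <= b -> `|g y| <= M) ->
  lebesgue_measure.-integrable `[a, b]
    (EFin \o (fun y : R => g y * `|y - x| `^ (- al))).
Proof.
move=> al01 mg gM.
have mI : measurable `[a, b]%classic by exact: measurable_itv.
have bg : [bounded g y | y in `[a, b]%classic].
  exists M; split; first exact: num_real.
  move=> M' MM' y /=; rewrite in_itv/= => yab.
  exact: le_trans (gM _ yab) (ltW MM').
have ik := integrable_kernel x a b al01.
have := @integrableMr _ _ R lebesgue_measure `[a, b]%classic mI g _ mg bg ik.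
exact.
Qed.

(** Discrete maximum principle: at an index [j] where the modulus of [e] is largest, the
    off-diagonal terms cancel at most their share of [A j j], so the modulus of [rho j] is at least
    that of [e j] times the row sum. Comparing [rho] with the sum of the same row lets the endpoint
    weights of both match. *)
Lemma M_matrix_bound (R : realFieldType) (n : nat) (A : 'M[R]_n)
    (e rho : 'cV[R]_n) (B : R) :
  (forall i k, k != i -> A i k <= 0) -> (forall i, 0 < \sum_k A i k) ->
  A *m e = rho -> (forall i, `|rho i 0| <= B * \sum_k A i k) ->
  forall i, `|e i 0| <= B.
Proof.
move=> offdiag rowsum Ae rhoB i.
pose j := [arg max_(j > i) `|e j 0|]%O.
have jmax k : `|e k 0| <= `|e j 0|.
  by rewrite /j; case: arg_maxP => // m _; exact.
apply: le_trans (jmax i) _.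
rewrite -(ler_pM2r (rowsum j)); apply: le_trans (rhoB j).
have -> : rho j 0 = A j j * e j 0 + \sum_(k | k != j) A j k * e k 0.
  by rewrite -Ae mxE (bigD1 j).
rewrite (bigD1 j)//= mulrDr.
have h1 : - (\sum_(k | k != j) A j k * e k 0) <=
    - (\sum_(k | k != j) A j k * `|e j 0|).
  rewrite -!sumrN; apply: ler_sum => k kj.
  rewrite -!mulNr ; apply: le_trans (ler_norm _) _; rewrite normrM.
  by rewrite ger0_norm ?oppr_ge0 ?offdiag// ler_wpM2l ?oppr_ge0 ?offdiag.
have h2 : \sum_(k | k != j) A j k * e k 0 <= - (\sum_(k | k != j) A j k * `|e j 0|).
  rewrite -sumrN; apply: ler_sum => k kj.
  apply: le_trans (ler_norm _) _; rewrite normrM -mulNr.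
  by rewrite ler0_norm ?offdiag// ler_wpM2l ?oppr_ge0 ?offdiag.
have -> : `|e j 0| * \sum_(k | k != j) A j k = \sum_(k | k != j) A j k * `|e j 0|.
  by rewrite mulr_sumr; apply: eq_bigr => k _; rewrite mulrC.
have h3 : `|e j 0| * A j j <= `|A j j * e j 0|.
  by rewrite normrM mulrC ler_wpM2r// ler_norm.
set S := \sum_(k | k != j) A j k * e k 0 in h1 h2 *.
have h4 : `|A j j * e j 0| <= `|A j j * e j 0 + S| + `|S|.
  by rewrite -{1}[A j j * e j 0](addrK S) ler_normB.
have h5 : `|S| <= - (\sum_(k | k != j) A j k * `|e j 0|).
  by rewrite ler_norml h2 lerNl h1.
lra.
Qed.

(** * Signs and row sums of the collocation matrix *)

Lemma mesh_interior (R : realType) (a b r : R) (N : nat)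
    (i : 'I_(2 * N).-1) : a < b -> 0 < r -> (0 < N)%N ->
  a + (b - a) / 2 * N%:R `^ (- r) <= mesh a b r N i.+1
    <= b - (b - a) / 2 * N%:R `^ (- r).
Proof.
move=> ab r0 N0; have N0' : 0 < N%:R :> R by rewrite ltr0n.
have e : (1%:R / N%:R) `^ r = N%:R `^ (- r) :> R.
  by rewrite div1r powRN -powR_inv1 ?ltW// -powRrM mulN1r powRN.
have i2N := interior_index i.
have N2 : (N <= (2 * N).-1)%N.
  by rewrite -ltnS prednK ?muln_gt0// mul2n -addnn -[ltnLHS]addn0 ltn_add2l.
have := @mesh_right _ a b r N (2 * N).-1 N0 N2 (leq_pred _).
have -> : (2 * N - (2 * N).-1)%N = 1%N.
  by rewrite -[X in (X - _)%N](@prednK (2 * N)) ?muln_gt0// subSnn.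
rewrite e => <-; have := @mesh_left _ a b r N 1 N0; rewrite e => <-.
by rewrite !mesh_le ?leq_pred// ltnW.
Qed.

(** Lets bounds on a single hat follow from those on combinations, by taking Kronecker data. *)
Lemma interior_comb_delta (R : realType) (N : nat) (phi : nat -> R -> R)
    (i : 'I_(2 * N).-1) (y : R) :
  interior_comb N phi (fun k => (k == i.+1)%:R) y = phi i.+1 y.
Proof.
rewrite /interior_comb (bigD1 i)//= eqxx mul1r big1 ?addr0// => j ji.
by rewrite eqSS (inj_eq val_inj) (negPf ji) mul0r.
Qed.

Lemma hat_between (R : realType) (a b r : R) (N : nat) (phi : nat -> R -> R)
    (i : 'I_(2 * N).-1) (y : R) : a < b -> 0 < r -> (0 < N)%N ->
  hat_functions a b r N phi -> a <= y <= b -> 0 <= phi i.+1 y <= 1.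
Proof.
move=> ab r0 N0 hat yab; rewrite -interior_comb_delta.
apply: (interior_comb_between ab r0 N0 hat _ _ _ yab) => //.
  by rewrite gtn_eqF ?interior_index.
by move=> k _; case: eqP => _; rewrite !lexx ler01.
Qed.

Lemma hat_measurable (R : realType) (a b r : R) (N : nat)
    (phi : nat -> R -> R) (j : nat) : (j <= 2 * N)%N ->
  hat_functions a b r N phi -> measurable_fun `[a, b]%classic (phi j).
Proof.
by move=> j2N /(_ _ j2N)[cphi _ _]; exact: subspace_continuous_measurable_fun.
Qed.

Lemma colloc_mxE (R : realType) (a b al r : R) (N : nat)
    (phi : nat -> R -> R) (i k : 'I_(2 * N).-1) :
  colloc_mx a b al r N phi i k =
  \int[lebesgue_measure]_(y in `[a, b]%classic)
    ((phi k.+1 (mesh a b r N i.+1) - phi k.+1 y)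
      * `|y - mesh a b r N i.+1| `^ (- al)).
Proof. by rewrite mxE; apply: eq_Rintegral => y _; rewrite powRN distrC. Qed.

Lemma colloc_integrable (R : realType) (a b al r : R) (N : nat)
    (phi : nat -> R -> R) (i k : 'I_(2 * N).-1) :
  a < b -> 0 < r -> 0 < al < 1 -> (0 < N)%N -> hat_functions a b r N phi ->
  lebesgue_measure.-integrable `[a, b]%classic (EFin \o
    (fun y => (phi k.+1 (mesh a b r N i.+1) - phi k.+1 y)
      * `|y - mesh a b r N i.+1| `^ (- al))).
Proof.
move=> ab r0 al01 N0 hat.
apply: (@integrable_bounded_kernel _ _ _ _ _ 1) => //.
  apply: measurable_funB => //; apply: hat_measurable hat.
  by rewrite ltnW// interior_index.
move=> y yab; have /andP[h1 h2] := hat_between k ab r0 N0 hat yab.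
have xab : a <= mesh a b r N i.+1 <= b.
  rewrite -[X in X <= _ <= _](mesh_first a b N r0).
  rewrite -[X in _ <= _ <= X](mesh_last a b r0 N0).
  by rewrite !mesh_le// ltnW// interior_index.
have /andP[h3 h4] := hat_between k ab r0 N0 hat xab.
by rewrite ler_norml; apply/andP; split; lra.
Qed.

(** Linearity merges a row into one integral of a nodal value minus the interpolant. Interior values
    1 give the row sums, and the values of [u] give the residual. *)
Lemma colloc_row (R : realType) (a b al r : R) (N : nat)
    (phi : nat -> R -> R) (w : nat -> R) (i : 'I_(2 * N).-1) :
  a < b -> 0 < r -> 0 < al < 1 -> (0 < N)%N -> hat_functions a b r N phi ->
  w 0%N = 0 -> w (2 * N)%N = 0 ->
  \sum_k colloc_mx a b al r N phi i k * w k.+1 =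
  \int[lebesgue_measure]_(y in `[a, b]%classic)
    ((w i.+1 - interior_comb N phi w y)
      * `|y - mesh a b r N i.+1| `^ (- al)).
Proof.
move=> ab r0 al01 N0 hat w0 w2N.
have mI : measurable `[a, b]%classic by exact: measurable_itv.
set x := mesh a b r N i.+1.
pose F (k : 'I_(2 * N).-1) y :=
  w k.+1 * ((phi k.+1 x - phi k.+1 y) * `|y - x| `^ (- al)).
have iF k : lebesgue_measure.-integrable `[a, b]%classic (EFin \o F k).
  have ik := colloc_integrable i k ab r0 al01 N0 hat.
  have := @integrableZl _ _ R lebesgue_measure `[a, b]%classic mI (w k.+1) _ ik.
  exact.
have -> : \sum_k colloc_mx a b al r N phi i k * w k.+1 =
    \sum_k \int[lebesgue_measure]_(y in `[a, b]%classic) F k y.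
  apply: eq_bigr => k _; rewrite colloc_mxE mulrC -RintegralZl//.
  exact: colloc_integrable.
have [_ ->] := @Rintegral_sum _ _ R lebesgue_measure `[a, b]%classic _
  (index_enum _) F mI iF.
apply: eq_Rintegral => y _.
have <- : interior_comb N phi w x = w i.+1.
  by rewrite (interior_comb_node hat)// ltnW// interior_index.
rewrite /interior_comb -sumrB mulr_suml; apply: eq_bigr => k _.
by rewrite /F mulrA mulrBr.
Qed.

Lemma colloc_offdiag_le0 (R : realType) (a b al r : R) (N : nat)
    (phi : nat -> R -> R) (i k : 'I_(2 * N).-1) :
  a < b -> 0 < r -> 0 < al < 1 -> (0 < N)%N -> hat_functions a b r N phi ->
  k != i -> colloc_mx a b al r N phi i k <= 0.
Proof.
move=> ab r0 al01 N0 hat ki; rewrite colloc_mxE.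
have mI : measurable `[a, b]%classic by exact: measurable_itv.
have [_ _ ->] := hat k.+1 (ltnW (interior_index k)); last first.
  by rewrite ltnW// interior_index.
rewrite eqSS (inj_eq val_inj) (negPf ki) /=.
rewrite -oppr_ge0 -mulN1r -RintegralZl//; last first.
  have := colloc_integrable i k ab r0 al01 N0 hat.
  have [_ _ ->] := hat k.+1 (ltnW (interior_index k)); last first.
    by rewrite ltnW// interior_index.
  by rewrite eqSS (inj_eq val_inj) (negPf ki).
apply: Rintegral_ge0 => y /=; rewrite in_itv/= => yab.
have /andP[h _] := hat_between k ab r0 N0 hat yab.
by rewrite sub0r mulN1r mulNr opprK mulr_ge0// powR_ge0.
Qed.

(** With interior nodal values 1, the function [g] is the share of the two end hats. On the half
    step next to [c] it is at least 1/2 and the kernel is at least its value at [c]; the half step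
    has length [s / 2], whence the factor [s / 4]. *)
Lemma colloc_rowsum_ge (R : realType) (a b al r c : R) (N : nat)
    (phi : nat -> R -> R) (i : 'I_(2 * N).-1) :
  a < b -> 0 < r -> 0 < al < 1 -> (0 < N)%N -> hat_functions a b r N phi ->
  c = a \/ c = b ->
  (b - a) / 2 * N%:R `^ (- r) / 4 * `|mesh a b r N i.+1 - c| `^ (- al)
    <= \sum_k colloc_mx a b al r N phi i k.
Proof.
move=> ab r0 al01 N0 hat cab.
have /andP[al0 al1] := al01.
pose w k : R := (0 < k < 2 * N)%N%:R.
have w0 : w 0%N = 0 by [].
have w2N : w (2 * N)%N = 0 by rewrite /w ltnn andbF.
have wi (k : 'I_(2 * N).-1) : w k.+1 = 1 by rewrite /w interior_index.
have -> : \sum_k colloc_mx a b al r N phi i k =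
    \sum_k colloc_mx a b al r N phi i k * w k.+1.
  by apply: eq_bigr => k _; rewrite wi mulr1.
rewrite colloc_row// wi.
have L0 : 0 < (b - a) / 2 by rewrite divr_gt0// subr_gt0.
have N0' : 0 < N%:R :> R by rewrite ltr0n.
have /andP[xs1 xs2] := mesh_interior i ab r0 N0.
set x := mesh a b r N i.+1 in xs1 xs2 *.
set s := (b - a) / 2 * N%:R `^ (- r) in xs1 xs2 *.
have s0 : 0 < s by rewrite mulr_gt0// powR_gt0.
pose g y := 1 - interior_comb N phi w y.
have comb01 y : a <= y <= b -> 0 <= interior_comb N phi w y <= 1.
  apply: (interior_comb_between ab r0 N0 hat w0 w2N) => k _.
  by rewrite /w; case: (0 < k < 2 * N)%N; rewrite !lexx ler01.
have mg : measurable_fun `[a, b]%classic g.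
  by apply: measurable_funB => //; exact: interior_comb_measurable hat.
have ig : lebesgue_measure.-integrable `[a, b]%classic
    (EFin \o (fun y => g y * `|y - x| `^ (- al))).
  apply: (@integrable_bounded_kernel _ _ _ _ _ 1) => // y /comb01/andP[h1 h2].
  by rewrite /g ger0_norm; lra.
(* The half step starts at [p = a] or at [p = b - s / 2]. Strict positivity of the distance matters,
   since the kernel takes the default value 0 at distance 0. *)
have [p [pa pb pJ]] : exists p, [/\ a <= p, p + s / 2 <= b &
    forall y, p <= y <= p + s / 2 -> 1 / 2 <= g y /\ 0 < `|y - x| <= `|x - c|].
  have N2 : (1 < 2 * N)%N by rewrite mul2n -addnn -[ltnLHS]add0n (leq_add N0 N0).
  have m1 : mesh a b r N 1 = a + s.
    rewrite mesh_left// /s; congr (_ + _ * _).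
    by rewrite div1r powRN -powR_inv1 ?ltW// -powRrM mulN1r powRN.
  have kE : (2 * N).-1.+1 = (2 * N)%N by rewrite prednK// (ltnW N2).
  have k2 : ((2 * N).-1 < 2 * N)%N by rewrite kE.
  have k0 : (0 < (2 * N).-1)%N by rewrite -ltnS kE.
  have m2 : mesh a b r N (2 * N).-1 = b - s.
    rewrite mesh_right ?(ltnW k2)//; last first.
      by rewrite -ltnS kE mul2n -addnn -[ltnLHS]addn0 ltn_add2l.
    have -> : (2 * N - (2 * N).-1)%N = 1%N by rewrite -{1}kE subSnn.
    rewrite /s; congr (_ - _ * _).
    by rewrite div1r powRN -powR_inv1 ?ltW// -powRrM mulN1r powRN.
  case: cab => ->.
    exists a; split; [by []|lra|move=> y /andP[y1 y2]]; split; last first.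
      rewrite ltr0_norm ?ger0_norm; [|lra|lra].
      by apply/andP; split; lra.
    have [A [B e]] := interior_comb_affine w hat (ltnW N2).
    rewrite (mesh_first a b N r0) m1 in e.
    have ea : A * a + B = 0.
      rewrite -e; last by apply/andP; split; lra.
      by rewrite -{1}(mesh_first a b N r0) (interior_comb_node hat).
    have es : A * (a + s) + B = 1.
      rewrite -e; last by apply/andP; split; lra.
      by rewrite -{1}m1 (interior_comb_node hat)// ?(ltnW N2)// /w N2.
    have As : A = s^-1.
      apply: (@mulIf _ s); rewrite ?gt_eqF// mulVf ?gt_eqF//; lra.
    rewrite /g e; last by apply/andP; split; lra.
    have -> : A * y + B = s^-1 * (y - a) by rewrite -As; lra.
    have : s^-1 * (y - a) <= s^-1 * (s / 2).
      by rewrite ler_pM2l ?invr_gt0//; lra.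
    by rewrite mulrA mulVf ?gt_eqF//; lra.
  exists (b - s / 2); split; [lra|lra|move=> y /andP[y1 y2]]; split; last first.
    rewrite ger0_norm ?ltr0_norm; [|lra|lra].
    by apply/andP; split; lra.
  have [A [B e]] := interior_comb_affine w hat k2.
  rewrite kE (mesh_last a b r0 N0) m2 in e.
  have eb : A * b + B = 0.
    rewrite -e; last by apply/andP; split; lra.
    by rewrite -{1}(mesh_last a b r0 N0) (interior_comb_node hat).
  have es : A * (b - s) + B = 1.
    rewrite -e; last by apply/andP; split; lra.
    by rewrite -{1}m2 (interior_comb_node hat)// ?(ltnW k2)// /w k0 k2.
  have As : A = - s^-1.
    apply: (@mulIf _ s); rewrite ?gt_eqF// mulNr mulVf ?gt_eqF//; lra.
  rewrite /g e; last by apply/andP; split; lra.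
  have -> : A * y + B = s^-1 * (b - y) by rewrite -[s^-1]opprK -As; lra.
  have : s^-1 * (b - y) <= s^-1 * (s / 2).
    by rewrite ler_pM2l ?invr_gt0//; lra.
  by rewrite mulrA mulVf ?gt_eqF//; lra.
rewrite -lee_fin /Rintegral fineK; last exact: integrable_fin_num.
have Jab : `[p, (p + s / 2)%R]%classic `<=` `[a, b]%classic.
  by move=> y /=; rewrite !in_itv/= => /andP[y1 y2]; apply/andP; split; lra.
have mint := measurable_int _ ig.
apply: (@le_trans _ _ (\int[lebesgue_measure]_(y in `[p, (p + s / 2)%R])
    (g y * `|y - x| `^ (- al))%:E)%E); last first.
  apply: ge0_subset_integral => // y /=; rewrite in_itv/= => /comb01/andP[h1 h2].
  by rewrite lee_fin mulr_ge0 ?powR_ge0// /g; lra.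
apply: (@le_trans _ _ (\int[lebesgue_measure]_(y in `[p, (p + s / 2)%R])
    (cst (1 / 2 * `|x - c| `^ (- al))%:E y))%E).
  rewrite integral_cst//= lebesgue_measure_itv/= lte_fin ifT; last by lra.
  by rewrite -EFinD -EFinM lee_fin; lra.
apply: ge0_le_integral => //.
- by move=> y _; rewrite lee_fin mulr_ge0// powR_ge0.
- exact: measurable_funS mint.
- move=> y /=; rewrite in_itv/= => /pJ[h1 /andP[h2 h3]].
  rewrite lee_fin; apply: ler_pM => //.
  by apply: ler_npowR => //; lra.
Qed.

(** * Residual estimate and convergence *)

(** Used with the first step as [s] at interior nodes, and with [s = 0] at all points of
    [[a, b]]. *)
Lemma endpoint_dist (R : realType) (a b c s x : R) : 0 <= s ->
  c = a \/ c = b -> a + s <= x <= b - s -> s <= `|x - c| <= b - a.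
Proof.
move=> s0 cab /andP[x1 x2]; case: cab => ->.
  by rewrite ger0_norm; [apply/andP; split; lra|lra].
by rewrite ler0_norm; [apply/andP; split; lra|lra].
Qed.

Lemma error_rate_ge0 (R : realType) (r sigma : R) (N : nat) : (2 <= N)%N ->
  0 <= error_rate r sigma N.
Proof.
move=> N2; rewrite /error_rate; case: ifP => _; first exact: powR_ge0.
case: ifP => _; last exact: powR_ge0.
by rewrite mulr_ge0 ?powR_ge0// ln_ge0// ler1n ltnW.
Qed.

(** The value [u x] cancels between the matrix row and [f x], which leaves the interpolation error
    integrated against the kernel. The first step and the endpoint weights are kept as factors, to
    be matched with the lower bound on the row sums. *)
Lemma residual_le (R : realType) (a b alpha r sigma : R) (f u : R -> R)
    (C0 : R) :
  a < b -> 0 < alpha < 1 -> 0 < r -> 0 < sigma < 1 ->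
  solves_nonlocal_problem a b alpha f u -> is_C2_on a b u ->
  (forall (l : nat) (x : R), (l <= 2)%N -> a < x < b ->
     `|(u^`(l))%classic x| <= C0 * ((x - a) * (b - x)) `^ (sigma - l%:R)) ->
  exists2 K : R, 0 <= K & forall (N : nat) (phi : nat -> R -> R)
      (i : 'I_(2 * N).-1), (2 <= N)%N -> hat_functions a b r N phi ->
    `|\sum_k colloc_mx a b alpha r N phi i k * u (mesh a b r N k.+1)
        - f (mesh a b r N i.+1)| <=
    K * error_rate r sigma N * ((b - a) / 2 * N%:R `^ (- r)) *
      (`|mesh a b r N i.+1 - a| `^ (- alpha)
       + `|mesh a b r N i.+1 - b| `^ (- alpha)).
Proof.
move=> ab al01 r0 s01 [uf u0] C2 bnd.
have ua : u a = 0 by apply: u0; rewrite ltxx.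
have ub : u b = 0 by apply: u0; rewrite ltxx andbF.
pose L := (b - a) / 2; have L0 : 0 < L by rewrite divr_gt0// subr_gt0.
have bL : 2 * L = b - a by rewrite /L; field.
have [Ke Ke0 interp] := interpolation_error ab r0 s01 C2 bnd ua ub.
have [Kw Kw0 weighted] := weighted_kernel_le (sigma - 2 / r) al01.
have [[C G] /= C_gt0 [dG rate]] := error_rate_ge sigma r0 L0.
have mI : measurable `[a, b]%classic by exact: measurable_itv.
(* Differentiability gives continuity in the open interval; adding the two endpoints preserves
   measurability. *)
have mu : measurable_fun `[a, b]%classic u.
  apply: (@measurable_fun_itv_cc _ a b false true).
  apply: open_continuous_measurable_fun; first exact: interval_open.
  move=> x; rewrite inE/= in_itv/= => xab.
  have [du _ _] := C2 _ xab.
  by move/derivable1_diffP : du; exact: differentiable_continuous.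
have [M uM] : exists M, forall y, a <= y <= b -> `|u y| <= M.
  exists (`|C0| * (2 * L * (2 * L)) `^ sigma) => y /andP[ay yb].
  have M0 : 0 <= `|C0| * (2 * L * (2 * L)) `^ sigma.
    by rewrite mulr_ge0 ?powR_ge0.
  have [->|ya] := eqVneq y a; first by rewrite ua normr0.
  have [->|yb'] := eqVneq y b; first by rewrite ub normr0.
  have yin : a < y < b by rewrite lt_neqAle eq_sym ya ay lt_neqAle yb' yb.
  apply: le_trans (bnd 0%N y isT yin) _; rewrite subr0.
  apply: (@le_trans _ _ (`|C0| * ((y - a) * (b - y)) `^ sigma)).
    by rewrite ler_wpM2r ?powR_ge0// ler_norm.
  rewrite ler_wpM2l//; apply: ler_ppowR.
  - by case/andP: s01 => /ltW.
  - by rewrite mulr_ge0 ?subr_ge0.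
  - by rewrite bL; apply: ler_pM; rewrite ?subr_ge0// ?lerD2l ?lerD2r ?lerN2.
(* Constants of the interpolation error, of the weighted kernel integral and of the rate, in this
   order. *)
exists (Ke * Kw * C) => [|N phi i N2 hat].
  by rewrite !mulr_ge0 ?(ltW Kw0) ?(ltW C_gt0).
have N0 : (0 < N)%N by exact: ltnW.
have N0' : 0 < N%:R :> R by rewrite ltr0n.
set v := fun k => u (mesh a b r N k).
have v0 : v 0%N = 0 by rewrite /v mesh_first.
have v2N : v (2 * N)%N = 0 by rewrite /v mesh_last.
rewrite (@colloc_row _ _ _ _ _ _ _ v)//.
have /andP[xs1 xs2] := mesh_interior i ab r0 N0.
rewrite -/L in xs1 xs2 *.
set s := L * N%:R `^ (- r) in xs1 xs2 *.
rewrite {1}/v; set x := mesh a b r N i.+1 in xs1 xs2 *.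
have s0 : 0 < s by rewrite mulr_gt0// powR_gt0.
have xin : a < x < b by apply/andP; split; lra.
have xab : a <= x <= b by case/andP: xin => *; rewrite !ltW.
have xs : a + s <= x <= b - s by rewrite xs1.
set P := interior_comb N phi v.
have PM y : a <= y <= b -> - M <= P y <= M.
  apply: (interior_comb_between ab r0 N0 hat v0 v2N) => k k2N.
  rewrite -ler_norml; apply: uM.
  rewrite -[X in X <= _ <= _](mesh_first a b N r0).
  by rewrite -[X in _ <= _ <= X](mesh_last a b r0 N0) !mesh_le.
have mP : measurable_fun `[a, b]%classic P.
  exact: interior_comb_measurable hat.
have i1 : lebesgue_measure.-integrable `[a, b]%classic
    (EFin \o (fun y => (u x - P y) * `|y - x| `^ (- alpha))).
  apply: (@integrable_bounded_kernel _ _ _ _ _ (2 * M)) => //.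
    exact: measurable_funB.
  move=> y yab; rewrite (le_trans (ler_normB _ _))// mulr_natl mulr2n.
  by rewrite lerD ?uM// ler_norml PM.
have i2 : lebesgue_measure.-integrable `[a, b]%classic
    (EFin \o (fun y => (u y - u x) * `|y - x| `^ (- alpha))).
  apply: (@integrable_bounded_kernel _ _ _ _ _ (2 * M)) => //.
    exact: measurable_funB.
  move=> y yab; rewrite (le_trans (ler_normB _ _))// mulr_natl mulr2n.
  by rewrite lerD ?uM.
have i3 : lebesgue_measure.-integrable `[a, b]%classic
    (EFin \o (fun y => (u y - P y) * `|y - x| `^ (- alpha))).
  apply: (@integrable_bounded_kernel _ _ _ _ _ (2 * M)) => //.
    exact: measurable_funB.
  move=> y yab; rewrite (le_trans (ler_normB _ _))// mulr_natl mulr2n.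
  by rewrite lerD ?uM// ler_norml PM.
have -> : f x = - \int[lebesgue_measure]_(y in `[a, b]%classic)
    ((u y - u x) * `|y - x| `^ (- alpha)).
  rewrite -(uf x xin); congr (- _); apply: eq_Rintegral => y _.
  by rewrite powRN distrC.
rewrite opprK -RintegralD//.
have -> : \int[lebesgue_measure]_(y in `[a, b]%classic)
    ((u x - P y) * `|y - x| `^ (- alpha) + (u y - u x) * `|y - x| `^ (- alpha)) =
  \int[lebesgue_measure]_(y in `[a, b]%classic)
    ((u y - P y) * `|y - x| `^ (- alpha)).
  by apply: eq_Rintegral => y _; ring.
rewrite -lee_fin EFin_normr_Rintegral//.
have mint := measurable_int _ i3.
apply: le_trans (le_abse_integral _ _ mint) _; first exact: mI.
pose k := sigma - 2 / r.
pose W c y := Num.max `|y - c| s `^ k * `|y - x| `^ (- alpha).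
have W0 c y : (0 <= (W c y)%:E)%E by rewrite lee_fin mulr_ge0 ?powR_ge0.
have mW c : measurable_fun `[a, b]%classic (fun y => (W c y)%:E).
  apply/measurable_EFinP; apply: measurable_funM.
    apply: measurable_funS (subsetT _) _ => //.
    apply: (measurableT_comp (measurable_powR k)).
    apply: measurable_maxr => //.
    by apply: measurableT_comp => //; exact: measurable_funB.
  exact: measurable_powR_dist.
pose K1 := Ke * N%:R `^ (- 2).
have K10 : 0 <= K1 by rewrite mulr_ge0// powR_ge0.
have Wbound c : c = a \/ c = b ->
    (\int[lebesgue_measure]_(y in `[a, b]) (W c y)%:E <=
     (Kw * `|x - c| `^ (- alpha) *
       (s `^ (k + 1) + (G (2 * L) - G s) + `|x - c| `^ (k + 1)))%:E)%E.
  move=> cab; apply: weighted => //.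
  - have /andP[h1 h2] := endpoint_dist (ltW s0) cab xs.
    by rewrite bL (le_trans h1).
  - move=> y /=; rewrite in_itv/= => yab.
    have yab0 : a + 0 <= y <= b - 0 by rewrite addr0 subr0.
    by have /andP[_] := endpoint_dist (lexx 0) cab yab0; rewrite bL.
  - by have /andP[] := endpoint_dist (ltW s0) cab xs.
have ratec c : c = a \/ c = b ->
    N%:R `^ (- 2) * (s `^ (k + 1) + (G (2 * L) - G s) + `|x - c| `^ (k + 1))
    <= C * s * error_rate r sigma N.
  move=> cab; apply: rate => //; rewrite bL.
  exact: (endpoint_dist (ltW s0) cab xs).
have mWab : measurable_fun `[a, b]%classic
    (fun y => ((W a y)%:E + (W b y)%:E)%E).
  by apply: emeasurable_funD; exact: mW.
have mKW : measurable_fun `[a, b]%classic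
    (fun y => (K1%:E * ((W a y)%:E + (W b y)%:E))%E).
  by apply: emeasurable_funM => //; exact: measurable_cst.
apply: (@le_trans _ _ (\int[lebesgue_measure]_(y in `[a, b])
    (K1%:E * ((W a y)%:E + (W b y)%:E))%E)%E).
  apply: ge0_le_integral => //.
  - exact: measurableT_comp.
  - move=> y /=; rewrite in_itv/= => yab.
    rewrite -EFinD -EFinM lee_fin normrM (ger0_norm (powR_ge0 _ _)).
    have h := interp N phi y N0 hat yab; rewrite -/L -/s -/v -/P in h.
    rewrite /W -mulrDl mulrA ler_wpM2r ?powR_ge0//.
rewrite ge0_integralZl//; last by move=> y _; rewrite adde_ge0.
rewrite ge0_integralD//; last first.
- exact: mW.
- exact: mW.
have Wa := Wbound a (or_introl erefl); have Wb := Wbound b (or_intror erefl).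
have K10e : (0 <= K1%:E)%E by rewrite lee_fin.
apply: le_trans (lee_wpmul2l K10e (leeD Wa Wb)) _.
rewrite -EFinD -EFinM lee_fin.
have ra := ratec a (or_introl erefl); have rb := ratec b (or_intror erefl).
set A := s `^ _ + _ + _ in ra *; set B := s `^ _ + _ + _ in rb *.
set da := `|x - a| `^ _; set db := `|x - b| `^ _.
have da0 : 0 <= da by exact: powR_ge0.
have db0 : 0 <= db by exact: powR_ge0.
have -> : K1 * (Kw * da * A + Kw * db * B) =
    Ke * Kw * (da * (N%:R `^ (- 2) * A) + db * (N%:R `^ (- 2) * B)).
  by rewrite /K1; ring.
have -> : Ke * Kw * C * error_rate r sigma N * s * (da + db) =
    Ke * Kw * (da * (C * s * error_rate r sigma N)
               + db * (C * s * error_rate r sigma N)) by ring.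
apply: ler_wpM2l; first by rewrite mulr_ge0// ltW.
by apply: lerD; apply: ler_wpM2l.
Qed.

Unset Implicit Arguments.
Set Strict Implicit.

Theorem theorem4p5 (R : realType) (a b alpha r sigma : R) (f u : R -> R)
    (C0 : R) (hab : a < b) (halpha : 0 < alpha < 1) (hr : 0 < r)
    (hsigma : 0 < sigma < 1)
    (hu : solves_nonlocal_problem a b alpha f u)
    (hC2 : is_C2_on a b u)
    (hbound : forall (l : nat) (x : R), (l <= 2)%N -> a < x < b ->
       `|(u^`(l))%classic x| <= C0 * ((x - a) * (b - x)) `^ (sigma - l%:R)) :
  exists2 C : R, 0 < C &
    forall (N : nat) (phi : nat -> R -> R) (U : 'cV[R]_((2 * N).-1)),
      (2 <= N)%N ->
      hat_functions a b r N phi ->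
      colloc_mx a b alpha r N phi *m U = colloc_rhs a b r N f ->
      \big[Num.max/0]_(i < (2 * N).-1)
          `|u (mesh a b r N i.+1) - U i 0| <= C * error_rate r sigma N.
Proof.
have [K K0 residual] := residual_le hab halpha hr hsigma hu hC2 hbound.
(* With [s] the first step, each endpoint weight times [s / 4] is at most the row sum, so [s] times
   the sum of both weights is at most 8 row sums. Adding 1 keeps the constant positive when
   [K = 0]. *)
exists (8 * K + 1) => [|N phi U N2 hat AU].
  by rewrite ltr_wpDl// mulr_ge0.
have N0 : (0 < N)%N by exact: ltnW.
have rate0 := error_rate_ge0 r sigma N2.
have Krate0 : 0 <= K * error_rate r sigma N by rewrite mulr_ge0.
set A := colloc_mx _ _ _ _ _ _ in AU.
pose e : 'cV[R]_((2 * N).-1) := \col_i (u (mesh a b r N i.+1) - U i 0).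
have s0 : 0 < (b - a) / 2 * N%:R `^ (- r).
  by rewrite mulr_gt0 ?powR_gt0 ?ltr0n// divr_gt0// subr_gt0.
have rs c i : c = a \/ c = b -> _ :=
  @colloc_rowsum_ge R a b alpha r c N phi i hab hr halpha N0 hat.
have xin i := mesh_interior i hab hr N0.
have rowsum i : 0 < \sum_k A i k.
  apply: lt_le_trans (rs a i (or_introl erefl)).
  rewrite mulr_gt0// ?divr_gt0// powR_gt0// normr_gt0 subr_eq0 gt_eqF//.
  by case/andP: (xin i) => h _; lra.
have bound := @M_matrix_bound R _ A e (A *m e) (8 * (K * error_rate r sigma N)).
apply: bigmax_le => [|i _].
  by rewrite mulr_ge0// addr_ge0// mulr_ge0.
have -> : u (mesh a b r N i.+1) - U i 0 = e i 0 by rewrite mxE.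
apply: (@le_trans _ _ (8 * (K * error_rate r sigma N))); last first.
  lra.
apply: bound => // {i} [i k|i].
  exact: colloc_offdiag_le0.
(* As [A *m U] collects the values of [f], applying [A] to the error gives the residual of the exact
   nodal values. *)
have -> : (A *m e) i 0 =
    \sum_k A i k * u (mesh a b r N k.+1) - f (mesh a b r N i.+1).
  have -> : f (mesh a b r N i.+1) = (A *m U) i 0 by rewrite AU mxE.
  rewrite !mxE -sumrB; apply: eq_bigr => k _.
  by rewrite [e k 0]mxE mulrBr.
apply: le_trans (residual N phi i N2 hat) _.
have ra := rs a i (or_introl erefl); have rb := rs b i (or_intror erefl).
have -> : 8 * (K * error_rate r sigma N) * \sum_k A i k =
    K * error_rate r sigma N * (8 * \sum_k A i k) by ring.
rewrite -mulrA ler_wpM2l//.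
lra.
Qed.
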